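(* Consider a continuous-time multi-agent system of $N$ identical agents $\dot x_i=Ax_i+Bu_i$, $y_i=Cx_i$ ($i=1,\dots,N$), with $x_i\in\mathbb{R}^n$, $u_i\in\mathbb{R}$, $y_i\in\mathbb{R}$. Each agent receives $\zeta_i=\sum_{j=1}^N\ell_{ij}y_j$ and $\hat\zeta_i=\sum_{j=1}^N\ell_{ij}H_cx_{j,c}$, and uses a collaborative linear protocol $$\dot x_{i,c}=A_cx_{i,c}+B_c\zeta_i+E_c\hat\zeta_i,\qquad u_i=F_cx_{i,c}+G^1_c\zeta_i+G^2_c\hat\zeta_i,$$ with $x_{i,c}\in\mathbb{R}^{n_c}$. The scale-free collaborative state synchronization problem asks for fixed matrices $A_c,B_c,E_c,F_c,G_c^1,G_c^2,H_c$ (independent of $N$ and of the graph) such that for every number of agents $N$, every weighted directed graph on $N$ nodes containing a directed spanning tree, and all initial conditions of agents and protocols, $\lim_{t\to\infty}(x_i(t)-x_j(t))=0$ for all $i,j$. This problem is solvable if and only if either $A$ is asymptotically stable (Hurwitz), or all of the following hold: $(A,B)$ is stabilizable, $(C,A)$ is detectable, and all eigenvalues of $A$ lie in the closed left-half complex plane.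
   Context: The network is described by a weighted directed graph on nodes $\{1,\dots,N\}$ with weighted adjacency matrix $[a_{ij}]$, $a_{ij}\ge0$, $a_{ii}=0$, where $a_{ij}>0$ means an edge from node $j$ to node $i$. The Laplacian $L=[\ell_{ij}]$ has $\ell_{ii}=\sum_k a_{ik}$ and $\ell_{ij}=-a_{ij}$ for $i\neq j$. A directed spanning tree exists iff some node has a directed path to every other node. *)

(* Defs.v *)
From HB Require Import structures.
From mathcomp Require Import all_boot all_order all_algebra.
From mathcomp Require Import complex.
From mathcomp Require Import all_classical all_reals all_analysis.
Set Implicit Arguments. Unset Strict Implicit. Unset Printing Implicit Defensive.
Import Order.TTheory GRing.Theory Num.Theory.
Import numFieldNormedType.Exports.
Local Open Scope classical_set_scope.
Local Open Scope ring_scope.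

Section Defs.
Variable R : realType.

Definition cmx n (A : 'M[R]_n) : 'M[R[i]]_n := map_mx (fun r => (r%:C)%C) A.

Definition hurwitz n (A : 'M[R]_n) : Prop :=
  forall z : R[i], eigenvalue (cmx A) z -> complex.Re z < 0.

Definition eig_closed_lhp n (A : 'M[R]_n) : Prop :=
  forall z : R[i], eigenvalue (cmx A) z -> complex.Re z <= 0.

Definition stabilizable n m (A : 'M[R]_n) (B : 'M[R]_(n, m)) : Prop :=
  exists F : 'M[R]_(m, n), hurwitz (A + B *m F).

Definition detectable n p (C : 'M[R]_(p, n)) (A : 'M[R]_n) : Prop :=
  exists K : 'M[R]_(n, p), hurwitz (A + K *m C).

(* weighted adjacency matrix: a i j >= 0 (edge j -> i iff a i j > 0), a i i = 0 *)
Definition adjacency N (a : 'M[R]_N) : Prop :=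
  (forall i j, 0 <= a i j) /\ (forall i, a i i = 0).

Definition laplacian N (a : 'M[R]_N) : 'M[R]_N :=
  \matrix_(i, j) (if i == j then \sum_(k < N) a i k else - a i j).

Definition edge N (a : 'M[R]_N) : rel 'I_N := fun u v => 0 < a v u.

Definition has_spanning_tree N (a : 'M[R]_N) : Prop :=
  exists r : 'I_N, forall i : 'I_N, connect (edge a) r i.

Definition has_deriv p q (f : R -> 'M[R]_(p, q)) (df : R -> 'M[R]_(p, q)) : Prop :=
  forall t (k : 'I_p) (l : 'I_q), is_derive t (1 : R) (fun s => f s k l) (df t k l).

Definition tends_to_zero p q (g : R -> 'M[R]_(p, q)) : Prop :=
  forall (k : 'I_p) (l : 'I_q), (fun t => g t k l) @ +oo --> (0 : R).

Definition closed_loop n nc q (A : 'M[R]_n) (B : 'M[R]_(n, 1)) (C : 'M[R]_(1, n))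
  (Ac : 'M[R]_nc) (Bc : 'M[R]_(nc, 1)) (Ec : 'M[R]_(nc, q)) (Fc : 'M[R]_(1, nc))
  (G1 : 'M[R]_1) (G2 : 'M[R]_(1, q)) (Hc : 'M[R]_(q, nc))
  N (a : 'M[R]_N) (x : 'I_N -> R -> 'cV[R]_n) (xc : 'I_N -> R -> 'cV[R]_nc) : Prop :=
  let L := laplacian a in
  let zeta i t : 'M[R]_1 := \sum_(j < N) L i j *: (C *m x j t) in
  let zetah i t : 'cV[R]_q := \sum_(j < N) L i j *: (Hc *m xc j t) in
  let u i t : 'M[R]_1 := Fc *m xc i t + G1 *m zeta i t + G2 *m zetah i t in
  forall i : 'I_N,
    has_deriv (x i) (fun t => A *m x i t + B *m u i t) /\
    has_deriv (xc i) (fun t => Ac *m xc i t + Bc *m zeta i t + Ec *m zetah i t).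

End Defs.

(* Main.v *)
(* Sufficiency.  If [A + B F] and [A + K C] are Hurwitz, let the protocol
   state be a pair (xh, chi) with u_i = F chi_i, where xh_i observes
   sum_j l_ij x_j and chi_i' = (A + B F) chi_i + xh_i - sum_j l_ij chi_j.
   Then sum_j l_ij x_j - xh_i decays through [A + K C], and e_i = x_i - chi_i
   satisfies e_i' = A e_i - sum_j l_ij e_j + o(1).  By the maximum principle,
   ker L^2 = ker L is spanned by the constant vector, and by Gershgorin the
   other eigenvalues of the Laplacian L have positive real part; so
   e_i - e_j -> 0, hence x_i - x_j -> 0.

   Necessity.  An eigenvector of a Laplacian for the eigenvalue w, multiplied
   by a solution of X' = (M0 + w M1) X, solves the closed loop; a leader
   followed by one agent realizes every w > 0.  So all solutions of these
   systems decay along the plant coordinates H.  Splitting off the unstable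
   roots of the characteristic polynomial gives H s(M) = 0 for M = M0 + w M1
   and a product s of factors X - z with Re z < 0.  The Popov-Belevitch-Hautus
   conditions follow at once, and imply the existence of gains by moving
   unstable eigenvalues one conjugate pair at a time.  Letting w tend to 0
   rules out eigenvalues of [A] with positive real part. *)

Require Import Defs.
From HB Require Import structures.
From mathcomp Require Import all_boot all_order all_algebra.
From mathcomp Require Import complex zify ring lra.
From mathcomp Require Import all_classical all_reals all_analysis.
Import Order.TTheory GRing.Theory Num.Theory.
Import numFieldNormedType.Exports.
Local Open Scope classical_set_scope.
Local Open Scope ring_scope.

Set Implicit Arguments.
Unset Strict Implicit.
Unset Printing Implicit Defensive.

(** * Eigenvalues of matrices *)

Section LinearFactors.
Context {F : fieldType}.

Definition mxprodXsubC m (M : 'M[F]_m) (zs : seq F) : 'M[F]_m :=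
  \big[mulmx/1%:M]_(z <- zs) (M - z%:M).

Lemma mxprodXsubC_nil m (M : 'M[F]_m) : mxprodXsubC M [::] = 1%:M.
Proof. exact: big_nil. Qed.

Lemma mxprodXsubC_cons m (M : 'M[F]_m) z zs :
  mxprodXsubC M (z :: zs) = (M - z%:M) *m mxprodXsubC M zs.
Proof. exact: big_cons. Qed.

Lemma mxprodXsubC_cat m (M : 'M[F]_m) s t :
  mxprodXsubC M (s ++ t) = mxprodXsubC M s *m mxprodXsubC M t.
Proof.
elim: s => [|z s IH]; first by rewrite mxprodXsubC_nil mul1mx.
by rewrite cat_cons !mxprodXsubC_cons IH mulmxA.
Qed.

Lemma horner_mx_prod_XsubC m (M : 'M[F]_m.+1) zs :
  horner_mx M (\prod_(z <- zs) ('X - z%:P)) = mxprodXsubC M zs.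
Proof.
elim: zs => [|z zs IH]; first by rewrite big_nil mxprodXsubC_nil rmorph1.
rewrite big_cons mxprodXsubC_cons rmorphM /= IH rmorphB /=.
by rewrite horner_mx_X horner_mx_C.
Qed.

Lemma perm_mxprodXsubC m (M : 'M[F]_m) s t :
  perm_eq s t -> mxprodXsubC M s = mxprodXsubC M t.
Proof.
case: m M => [|m] M st; first by rewrite [LHS]flatmx0 [RHS]flatmx0.
by rewrite -!horner_mx_prod_XsubC (perm_big _ st).
Qed.

Lemma mxprodXsubC_rcons m (M : 'M[F]_m) z zs :
  mxprodXsubC M (rcons zs z) = mxprodXsubC M zs *m (M - z%:M).
Proof.
by rewrite -cats1 mxprodXsubC_cat mxprodXsubC_cons mxprodXsubC_nil mulmx1.
Qed.

Lemma mxprodXsubC_consr m (M : 'M[F]_m) z zs :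
  mxprodXsubC M (z :: zs) = mxprodXsubC M zs *m (M - z%:M).
Proof.
rewrite -mxprodXsubC_rcons; apply: perm_mxprodXsubC.
by rewrite perm_sym perm_rcons.
Qed.

Lemma mxprodXsubC_tr m (M : 'M[F]_m) zs :
  mxprodXsubC M^T zs = (mxprodXsubC M zs)^T.
Proof.
elim: zs => [|z zs IH]; first by rewrite !mxprodXsubC_nil trmx1.
rewrite mxprodXsubC_cons mxprodXsubC_consr IH trmx_mul.
by rewrite [(_ - _)^T]linearB /= tr_scalar_mx.
Qed.

Lemma mxprodXsubC_eigencol m p (M : 'M[F]_m) zs z (v : 'M[F]_(m, p)) :
  M *m v = z *: v -> mxprodXsubC M zs *m v = (\prod_(w <- zs) (z - w)) *: v.
Proof.
move=> Mv; elim: zs => [|w zs IH].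
  by rewrite mxprodXsubC_nil big_nil mul1mx scale1r.
rewrite mxprodXsubC_cons -mulmxA IH -scalemxAr mulmxBl Mv mul_scalar_mx.
by rewrite -scalerBl scalerA big_cons mulrC.
Qed.

End LinearFactors.

Section Spectrum.
Context {F : closedFieldType} {m : nat}.
Implicit Type M : 'M[F]_m.

Definition spectrum M : seq F := sval (closed_field_poly_normal (char_poly M)).

Lemma char_poly_spectrum M : char_poly M = \prod_(z <- spectrum M) ('X - z%:P).
Proof.
rewrite /spectrum; case: closed_field_poly_normal => zs /= {1}->.
by rewrite (monicP (char_poly_monic M)) scale1r.
Qed.

Lemma size_spectrum M : size (spectrum M) = m.
Proof.
by have := size_char_poly M; rewrite char_poly_spectrum size_prod_XsubC => -[].
Qed.

Lemma mem_spectrum M z : (z \in spectrum M) = eigenvalue M z.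
Proof. by rewrite eigenvalue_root_char char_poly_spectrum root_prod_XsubC. Qed.

Lemma mxprodXsubC_spectrum M : mxprodXsubC M (spectrum M) = 0.
Proof.
have := char_poly_spectrum M; case: m M (spectrum M) => [|k] M zs ch.
  by rewrite [LHS]flatmx0.
by rewrite -horner_mx_prod_XsubC -ch Cayley_Hamilton.
Qed.

Lemma mxprodXsubC_filter_spectrum M (p : pred F) :
  mxprodXsubC M [seq z <- spectrum M | p z]
    *m mxprodXsubC M [seq z <- spectrum M | predC p z] = 0.
Proof.
rewrite -mxprodXsubC_cat -(mxprodXsubC_spectrum M); apply: perm_mxprodXsubC.
by rewrite perm_filterC.
Qed.

End Spectrum.

Lemma eigenvalue_tr (F : fieldType) m (M : 'M[F]_m) z :
  eigenvalue M^T z = eigenvalue M z.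
Proof.
rewrite !eigenvalue_root_char; congr (root _ z); rewrite /char_poly -det_tr.
by congr (\det _); apply/matrixP => i j; rewrite !mxE eq_sym.
Qed.

Lemma eigenvalue_sub_scalar (F : fieldType) m (M : 'M[F]_m) z w :
  eigenvalue (M - z%:M) w = eigenvalue M (w + z).
Proof.
apply/eigenvalueP/eigenvalueP => -[v vM v0]; exists v => //.
  by rewrite scalerDl -vM mulmxBr mul_mx_scalar subrK.
by rewrite mulmxBr mul_mx_scalar vM scalerDl addrK.
Qed.

Lemma eigencolP (F : fieldType) m (M : 'M[F]_m) z :
  reflect (exists2 v : 'cV_m, M *m v = z *: v & v != 0) (eigenvalue M z).
Proof.
rewrite -eigenvalue_tr; apply: (iffP eigenvalueP) => -[v vM v0]; exists v^T;
  rewrite ?trmx_eq0 //.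
- by rewrite -[LHS]trmxK trmx_mul trmxK vM linearZ.
- by rewrite -trmx_mul vM linearZ.
Qed.

Lemma gershgorin_disc (F : numFieldType) m (M : 'M[F]_m) z : eigenvalue M z ->
  exists i, `|z - M i i| <= \sum_(j | j != i) `|M i j|.
Proof.
move=> /eigencolP[v Mv v0].
have [i0 _] : exists i, v i 0 != 0.
  apply/existsP; apply: contraNT v0 => /existsPn v0.
  by apply/eqP/colP => i; rewrite mxE; apply/eqP/negPn.
have [i _ vmax] := real_arg_maxP (P := xpredT) (i0 := i0)
  (F := fun i => `|v i 0|) isT (fun i _ => normr_real (v i 0)).
exists i; have vi0 : 0 < `|v i 0|.
  rewrite lt_def normr_ge0 andbT; apply: contraNneq v0 => vi.
  apply/eqP/colP => k; rewrite mxE; apply/eqP.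
  by rewrite -normr_le0 -vi; exact: vmax.
rewrite -(ler_pM2r vi0) -normrM mulr_suml.
have -> : (z - M i i) * v i 0 = \sum_(j | j != i) M i j * v j 0.
  have := congr1 (fun Z : 'cV_m => Z i 0) Mv; rewrite !mxE (bigD1 i) //= => zv.
  by rewrite mulrBl -zv addrAC subrr add0r.
apply: le_trans (ler_norm_sum _ _ _) _; apply: ler_sum => j _.
by rewrite normrM ler_wpM2l //; exact: vmax.
Qed.

(** * Rank-one updates of the characteristic polynomial *)

(* Both sides come from the block matrix [[P, b], [g, 1]]; cancelling powers of
   [\det P] needs it to be regular, not invertible. *)
Lemma det_sub_col_row_lreg (R : comNzRingType) m (P : 'M[R]_m) (b : 'cV_m)
    (g : 'rV_m) :
  GRing.lreg (\det P) -> \det (P - b *m g) = \det P - (g *m \adj P *m b) 0 0.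
Proof.
move=> Preg; set N := block_mx P b g (1%:M : 'M[R]_1).
have N_eliminate_row : \det N = \det (P - b *m g).
  have : \det (N *m block_mx 1%:M 0 (- g) 1%:M) = \det (P - b *m g).
    rewrite mulmx_block !mulmx1 !mulmx0 !add0r mulmxN mul1mx subrr.
    by rewrite det_ublock det1 mulr1.
  by rewrite det_mulmx det_lblock !det1 !mulr1.
have : \det (N *m block_mx (\adj P) (- (\adj P *m b)) 0 (\det P)%:M) =
    \det P ^+ m * (\det P - (g *m \adj P *m b) 0 0).
  rewrite mulmx_block !mulmx0 !addr0 !mulmxN !mulmxA mul_mx_adj mul1mx.
  rewrite mul_mx_scalar mul_scalar_mx addNr det_lblock det_scalar.
  congr (_ * _); by rewrite det_mx11 !mxE eqxx mulr1n addrC.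
rewrite det_mulmx det_ublock det_scalar1 N_eliminate_row.
rewrite [\det (\adj P) * _]mulrC -det_mulmx mul_mx_adj det_scalar mulrC.
exact: lregX.
Qed.

Lemma det_sub_col_row (R : comNzRingType) m (P : 'M[R]_m) (b : 'cV_m)
    (g : 'rV_m) :
  \det (P - b *m g) = \det P - (g *m \adj P *m b) 0 0.
Proof.
(* The matrix ['X + P] has a monic determinant; evaluate at ['X = 0]. *)
pose Q := char_poly_mx (- P).
have polyC_at0 p q (M : 'M[R]_(p, q)) :
    map_mx (horner_eval 0) (map_mx polyC M) = M.
  by apply/matrixP => i j; rewrite !mxE /horner_eval hornerC.
have Q_at0 : map_mx (horner_eval 0) Q = P.
  apply/matrixP => i j; rewrite !mxE /horner_eval !hornerE.
  by case: (i == j); rewrite ?mulr1n ?mulr0n ?hornerE ?sub0r opprK.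
have /(congr1 (horner_eval 0)) := det_sub_col_row_lreg (map_mx polyC b)
  (map_mx polyC g) (monic_lreg (char_poly_monic (- P))).
have horner0_entry (M : 'M[{poly R}]_1) :
    horner_eval 0 (M 0 0) = map_mx (horner_eval 0) M 0 0.
  by rewrite mxE.
rewrite rmorphB /= horner0_entry -!det_map_mx map_mxB !map_mxM map_mx_adj.
by rewrite -/Q Q_at0 !polyC_at0.
Qed.

Lemma char_poly_add_col_row (R : comNzRingType) m (A : 'M[R]_m) (b : 'cV_m)
    (r : 'rV_m) :
  char_poly (A + b *m r) = char_poly A
    - (map_mx polyC r *m \adj (char_poly_mx A) *m map_mx polyC b) 0 0.
Proof.
rewrite -det_sub_col_row /char_poly /char_poly_mx map_mxD map_mxM.
by rewrite opprD addrA.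
Qed.

Lemma eigenrow_adj_char_poly_mx (R : comNzRingType) m p (A : 'M[R]_m)
    (r : 'M[R]_(p, m)) z :
  r *m A = z *: r ->
  ('X - z%:P) *: (map_mx polyC r *m \adj (char_poly_mx A)) =
  char_poly A *: map_mx polyC r.
Proof.
move=> rA.
have rP : map_mx polyC r *m char_poly_mx A = ('X - z%:P) *: map_mx polyC r.
  rewrite mulmxBr -map_mxM rA mul_mx_scalar scalerBl.
  by congr (_ - _); apply/matrixP => i j; rewrite !mxE /= polyCM.
by rewrite scalemxAl -rP -mulmxA mul_mx_adj mul_mx_scalar.
Qed.

Lemma char_poly_add_two_eigenrows (R : comNzRingType) m (A : 'M[R]_m)
    (b : 'cV_m) (r1 r2 : 'rV_m) z1 z2 :
  r1 *m A = z1 *: r1 -> r2 *m A = z2 *: r2 ->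
  ('X - z1%:P) * ('X - z2%:P) * char_poly (A + b *m (r1 + r2)) =
  char_poly A * (('X - z1%:P) * ('X - z2%:P)
     - ((r1 *m b) 0 0)%:P * ('X - z2%:P) - ((r2 *m b) 0 0)%:P * ('X - z1%:P)).
Proof.
pose resolvent (r : 'rV_m) :=
  (map_mx polyC r *m \adj (char_poly_mx A) *m map_mx polyC b) 0 0.
have resolventE (r : 'rV_m) z : r *m A = z *: r ->
    ('X - z%:P) * resolvent r = char_poly A * ((r *m b) 0 0)%:P.
  move=> /eigenrow_adj_char_poly_mx.
  move=> /(congr1 (fun Z => (Z *m map_mx polyC b) 0 0)).
  by rewrite -!scalemxAl -map_mxM [LHS]mxE [RHS]mxE [in RHS]mxE.
move=> /resolventE r1E /resolventE r2E.
rewrite char_poly_add_col_row map_mxD !mulmxDl mxE -!/(resolvent _).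
transitivity (('X - z1%:P) * ('X - z2%:P) * char_poly A
    - ('X - z2%:P) * (('X - z1%:P) * resolvent r1)
    - ('X - z1%:P) * (('X - z2%:P) * resolvent r2)); first by ring.
by rewrite r1E r2E; ring.
Qed.

(** * Stabilization by eigenvalue shifting *)

Lemma relocate_XsubC_pair (D : comNzRingType) (z z' b b' u v : D) :
  z + z' + b + b' = u + v -> z * z' + b * z' + b' * z = u * v ->
  ('X - z%:P) * ('X - z'%:P) - b%:P * ('X - z'%:P) - b'%:P * ('X - z%:P) =
  ('X - u%:P) * ('X - v%:P) :> {poly D}.
Proof.
move=> sumE prodE; transitivity ('X ^+ 2 - (z + z' + b + b')%:P * 'X
    + (z * z' + b * z' + b' * z)%:P); first by rewrite !(polyCD, polyCM); ring.
by rewrite sumE prodE !(polyCD, polyCM); ring.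
Qed.

Local Notation mxC := (map_mx (real_complex _)).

Section PoleShifting.
Variable R : realType.
Local Notation C := R[i].
Local Notation Re := (@complex.Re R).

Lemma mxC_conj m n (M : 'M[R]_(m, n)) : map_mx conjc (mxC M) = mxC M.
Proof. by apply/matrixP => i j; rewrite !mxE conjc_real. Qed.

Definition add_conj_mx m n (M : 'M[C]_(m, n)) : 'M[R]_(m, n) :=
  map_mx (fun z => Re z + Re z) M.

Lemma add_conj_mxE m n (M : 'M[C]_(m, n)) :
  mxC (add_conj_mx M) = M + map_mx conjc M.
Proof.
apply/matrixP => i j; rewrite !mxE; case: (M i j) => a b /=.
by apply/eqP; rewrite eq_complex /= subrr !eqxx.
Qed.

(* A real [z] is a double root here, of which only one copy moves. *)
Lemma relocate_conj_pair (z : C) : exists b u : C, (u = -1 \/ u = z) /\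
  ('X - z%:P) * ('X - (conjc z)%:P) - b%:P * ('X - (conjc z)%:P)
    - (conjc b)%:P * ('X - z%:P) = ('X - (-1)%:P) * ('X - u%:P).
Proof.
case: z => x y; have [->|y0] := eqVneq y 0.
  exists (Complex (- (x + 1) / 2) 0), (Complex x 0); split; first by right.
  by apply: relocate_XsubC_pair; apply/eqP; rewrite eq_complex /=;
    apply/andP; split; apply/eqP; field.
pose b1 := - 1 - x; pose b2 := (1 - x ^+ 2 - y ^+ 2 - 2 * x * b1) / (2 * y).
exists (Complex b1 b2), (-1); split; first by left.
apply: relocate_XsubC_pair; apply/eqP; rewrite eq_complex /=; apply/andP; split;
  by apply/eqP; rewrite /b2 /b1; field.
Qed.

Lemma char_poly_conj_feedback n m (A : 'M[R]_n) (b : 'M[R]_(n, m))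
    (g : 'cV[R]_m) (s : 'rV[C]_n) z beta :
  s *m mxC A = z *: s -> (s *m mxC (b *m g)) 0 0 = beta ->
  ('X - z%:P) * ('X - (conjc z)%:P)
    * char_poly (mxC (A + b *m (g *m add_conj_mx s))) =
  char_poly (mxC A) * (('X - z%:P) * ('X - (conjc z)%:P)
    - beta%:P * ('X - (conjc z)%:P) - (conjc beta)%:P * ('X - z%:P)).
Proof.
move=> sA sbg; have sJA : map_mx conjc s *m mxC A = conjc z *: map_mx conjc s.
  by rewrite -(mxC_conj A) -map_mxM sA map_mxZ.
rewrite mulmxA map_mxD map_mxM add_conj_mxE.
rewrite (char_poly_add_two_eigenrows _ sA sJA) sbg.
by rewrite -(mxC_conj (b *m g)) -map_mxM [map_mx conjc _ 0 0]mxE sbg.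
Qed.

Definition pbh_stabilizable n m (A : 'M[R]_n) (B : 'M[R]_(n, m)) : Prop :=
  forall (z : C) (r : 'rV[C]_n), 0 <= Re z ->
    r *m mxC A = z *: r -> r *m mxC B = 0 -> r = 0.

Lemma pbh_stabilizable_feedback n m (A : 'M[R]_n) (B : 'M[R]_(n, m)) F :
  pbh_stabilizable A B -> pbh_stabilizable (A + B *m F) B.
Proof.
move=> pbh z r z0; rewrite map_mxD map_mxM mulmxDr mulmxA => rA rB.
by apply: (pbh z) => //; rewrite -rA rB mul0mx addr0.
Qed.

Definition unstable : pred C := fun z => 0 <= Re z.

Definition unstable_count n (A : 'M[R]_n) : nat :=
  count unstable (spectrum (mxC A)).

Lemma unstable_count_eq0 n (A : 'M[R]_n) : unstable_count A = 0%N -> hurwitz A.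
Proof.
move=> /eqP; rewrite -leqn0 leqNgt -has_count => /hasPn stab z.
by rewrite -mem_spectrum => /stab; rewrite /unstable -ltNge.
Qed.

Lemma relocation_decreases_count z u (zs zs' : seq C) :
  unstable z -> u = -1 \/ u = z ->
  ('X - z%:P) * ('X - (conjc z)%:P) * \prod_(w <- zs') ('X - w%:P) =
  \prod_(w <- zs) ('X - w%:P) * (('X - (-1)%:P) * ('X - u%:P)) ->
  (count unstable zs' < count unstable zs)%N.
Proof.
move=> z0 uE rootsE; have /permP/(_ unstable) :
    perm_eq [:: z, conjc z & zs'] [:: -1, u & zs].
  apply: prod_XsubC_eq; rewrite !big_cons mulrA rootsE.
  by rewrite [LHS]mulrC -mulrA.
have zJ0 : unstable (conjc z) by move: z0; case: (z).
have N1stable : unstable (-1) = false.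
  by rewrite /unstable /= oppr_ge0 leNgt ltr01.
by rewrite /= z0 zJ0 N1stable; case: uE => ->; rewrite ?N1stable ?z0 /=; lia.
Qed.

Lemma feedback_decreases_unstable_count n m (A : 'M[R]_n) (B : 'M[R]_(n, m)) :
  pbh_stabilizable A B -> (0 < unstable_count A)%N ->
  exists F, (unstable_count (A + B *m F) < unstable_count A)%N.
Proof.
move=> pbh; rewrite {1}/unstable_count -has_count => /hasP[z].
rewrite mem_spectrum => /eigenvalueP[r rA r0] z0.
have [j rBj] : exists j, (r *m mxC B) 0 j != 0.
  apply/existsP; apply: contraNT r0 => /existsPn rB0; apply/eqP/(pbh z) => //.
  by apply/rowP => j; rewrite [RHS]mxE; apply/eqP/negPn.
have [beta [u [uE quadE]]] := relocate_conj_pair z.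
pose s := (beta / (r *m mxC B) 0 j) *: r; pose g : 'cV[R]_m := delta_mx j 0.
have sA : s *m mxC A = z *: s by rewrite -scalemxAl rA !scalerA mulrC.
have sB : (s *m mxC (B *m g)) 0 0 = beta.
  by rewrite map_mxM map_delta_mx mulmxA -colE mxE -scalemxAl mxE divfK.
exists (g *m add_conj_mx s); have := char_poly_conj_feedback sA sB.
rewrite quadE !char_poly_spectrum => rootsE.
exact: relocation_decreases_count z0 uE rootsE.
Qed.

Lemma stabilizable_of_pbh n m (A : 'M[R]_n) (B : 'M[R]_(n, m)) :
  pbh_stabilizable A B -> stabilizable A B.
Proof.
have [k] := ubnP (unstable_count A); elim: k A => // k IH A Ak pbh.
have [/unstable_count_eq0 hA|A0] := posnP (unstable_count A).
  by exists 0; rewrite mulmx0 addr0.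
have [F FA] := feedback_decreases_unstable_count pbh A0.
have [F' hF'] := IH _ (leq_trans FA Ak) (pbh_stabilizable_feedback pbh).
by exists (F + F'); rewrite mulmxDr addrA.
Qed.

Lemma detectable_of_stabilizable_tr n p (D : 'M[R]_(p, n)) (A : 'M[R]_n) :
  stabilizable A^T D^T -> detectable D A.
Proof.
move=> [F hF]; exists F^T => z; rewrite -eigenvalue_tr => zE; apply: hF.
suff -> : cmx (A^T + D^T *m F) = (cmx (A + F^T *m D))^T by [].
by rewrite /cmx [RHS]map_trmx [(_ + _)^T]linearD /= trmx_mul trmxK.
Qed.

End PoleShifting.

(** * Limits of matrix functions *)

HB.instance Definition _ (R : rcfType) := NormedModule.copy R[i] R[i]^o.

Section MatrixNorm.
Context {K : numDomainType}.

Lemma mx_norm_le m n (M : 'M[K]_(m, n)) e :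
  0 <= e -> (forall i j, `|M i j| <= e) -> `|M| <= e.
Proof.
move=> e0 Me; rewrite [`|M|]mx_normE -[e]/(NngNum e0)%:num num_le.
by apply/bigmax_leP; split=> [|[i j] _]; rewrite -num_le //=; exact: Me.
Qed.

Lemma mx_entry_le_norm m n (M : 'M[K]_(m, n)) i j : `|M i j| <= `|M|.
Proof.
rewrite -[leLHS]/`|M (i, j).1 (i, j).2| [leRHS]mx_normE -[leLHS]nngE num_le.
exact: le_bigmax.
Qed.

Lemma mx_norm_usubmx m1 m2 n (M : 'M[K]_(m1 + m2, n)) : `|usubmx M| <= `|M|.
Proof. by apply: mx_norm_le => // i j; rewrite mxE mx_entry_le_norm. Qed.

Lemma mx_norm_mulmx m n p (P : 'M[K]_(m, n)) (Q : 'M[K]_(n, p)) :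
  `|P *m Q| <= n%:R * `|P| * `|Q|.
Proof.
apply: mx_norm_le => [|i j]; first by rewrite !mulr_ge0.
rewrite mxE -mulrA mulr_natl -[n in _ *+ n]card_ord -sumr_const.
apply: le_trans (ler_norm_sum _ _ _) _; apply: ler_sum => k _.
by rewrite normrM ler_pM // mx_entry_le_norm.
Qed.

End MatrixNorm.

Section MatrixLimits.
Context {K : numFieldType} {T : Type} {F : set_system T} {FF : Filter F}.

Lemma cvg_mx0P m n (X : T -> 'M[K]_(m, n)) :
  X t @[t --> F] --> (0 : 'M[K]_(m, n)) <->
  forall i j, X t i j @[t --> F] --> (0 : K).
Proof.
split=> [X0 i j|X0]; apply/cvgr0Pnorm_le => e e0.
  move/cvgr0Pnorm_le: X0 => /(_ e e0); apply: filterS => t.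
  exact/le_trans/mx_entry_le_norm.
have : \forall t \near F, forall ij : 'I_m * 'I_n, `|X t ij.1 ij.2| <= e.
  by apply: filter_forall => -[i j] /=; move/cvgr0Pnorm_le: (X0 i j); exact.
apply: filterS => t Xt; apply: mx_norm_le => [|i j]; first exact: ltW.
exact: (Xt (i, j)).
Qed.

Lemma cvg0D (V : normedModType K) (f g : T -> V) :
  f t @[t --> F] --> (0 : V) -> g t @[t --> F] --> (0 : V) ->
  f t + g t @[t --> F] --> (0 : V).
Proof. by move=> f0 g0; rewrite -(addr0 0); apply: cvgD. Qed.

Lemma cvg0N (V : normedModType K) (f : T -> V) :
  f t @[t --> F] --> (0 : V) -> - f t @[t --> F] --> (0 : V).
Proof. by move=> f0; rewrite -oppr0; apply: cvgN. Qed.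

Lemma cvg0_sum (V : normedModType K) (I : Type) (r : seq I) (f : I -> T -> V) :
  (forall i, f i t @[t --> F] --> (0 : V)) ->
  \sum_(i <- r) f i t @[t --> F] --> (0 : V).
Proof.
move=> f0; elim: r => [|i r IH].
  by under eq_fun do rewrite big_nil; exact: cvg_cst.
by under eq_fun do rewrite big_cons; exact: cvg0D.
Qed.

Lemma cvg0_mulmxl m n p (P : 'M[K]_(m, n)) (X : T -> 'M[K]_(n, p)) :
  X t @[t --> F] --> (0 : 'M[K]_(n, p)) ->
  P *m X t @[t --> F] --> (0 : 'M[K]_(m, p)).
Proof.
move=> /cvg_mx0P X0; apply/cvg_mx0P => i j; under eq_fun do rewrite mxE.
by apply: cvg0_sum => k; rewrite -(mulr0 (P i k)); apply: cvgMr.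
Qed.

Lemma cvg0_mulmxr m n p (P : 'M[K]_(n, p)) (X : T -> 'M[K]_(m, n)) :
  X t @[t --> F] --> (0 : 'M[K]_(m, n)) ->
  X t *m P @[t --> F] --> (0 : 'M[K]_(m, p)).
Proof.
move=> /cvg_mx0P X0; apply/cvg_mx0P => i j; under eq_fun do rewrite mxE.
by apply: cvg0_sum => k; rewrite -(mul0r (P k j)); apply: cvgMl.
Qed.

End MatrixLimits.

Section ComplexLimits.
Variables (R : rcfType) (T : Type) (F : set_system T) (FF : Filter F).
Local Notation C := R[i].
Local Notation Re := (@complex.Re R).
Local Notation Im := (@complex.Im R).

Definition sqrnormc (z : C) : R := Re z ^+ 2 + Im z ^+ 2.

Lemma sqrnormc_ge0 z : 0 <= sqrnormc z.
Proof. by rewrite addr_ge0 ?sqr_ge0. Qed.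

Lemma sqrnormc_eq0 z : (sqrnormc z == 0) = (z == 0).
Proof.
rewrite /sqrnormc paddr_eq0 ?sqr_ge0 // !sqrf_eq0.
by case: z => x y; rewrite eq_complex.
Qed.

Lemma cvg0_sqrnormc (f : T -> C) :
  f t @[t --> F] --> (0 : C) <-> sqrnormc (f t) @[t --> F] --> (0 : R).
Proof.
have realC (e : C) : 0 < e -> e = (Re e)%:C%C by move=> /gtr0_real/RRe_real.
split=> /cvgr0Pnorm_lt f0; apply/cvgr0Pnorm_lt => e e0.
  have e0' : 0 < Num.sqrt e by rewrite sqrtr_gt0.
  have := f0 (Num.sqrt e)%:C%C; rewrite ltcR => /(_ e0').
  apply: filterS => t; rewrite (ger0_norm (sqrnormc_ge0 _)) normc_def ltcR.
  by rewrite ltr_sqrt.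
have eR := realC e e0; have e0' : 0 < Re e by rewrite -ltcR -eR.
have := f0 (Re e ^+ 2); rewrite exprn_gt0 // => /(_ isT); apply: filterS => t.
rewrite (ger0_norm (sqrnormc_ge0 _)) normc_def {2}eR ltcR => fe.
by rewrite -[ltRHS]ger0_norm ?ltW // -sqrtr_sqr ltr_sqrt // exprn_gt0.
Qed.

Lemma cvg0_real_complex (f : T -> R) :
  (f t)%:C%C @[t --> F] --> (0 : C) <-> f t @[t --> F] --> (0 : R).
Proof.
have normE x : `|x%:C%C : C| = `|x|%:C%C.
  by rewrite normc_def /= expr0n addr0 sqrtr_sqr.
split=> /cvgr0Pnorm_lt f0; apply/cvgr0Pnorm_lt => e e0.
  have := f0 e%:C%C; rewrite ltcR => /(_ e0); apply: filterS => t.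
  by rewrite normE ltcR.
have eR : e = (Re e)%:C%C by rewrite RRe_real // gtr0_real.
have := f0 (Re e); rewrite -ltcR -eR => /(_ e0); apply: filterS => t.
by rewrite normE eR ltcR.
Qed.

End ComplexLimits.

(** * Decay of solutions of linear differential equations *)

Section RealDecay.
Variable R : realType.
Implicit Types h dh g : R -> R.

Lemma is_derive_nincr h dh (T : R) :
  (forall t, is_derive t (1 : R) h (dh t)) -> (forall t, T < t -> dh t <= 0) ->
  forall t, T <= t -> h t <= h T.
Proof.
move=> hd dh0 t Tt; have derh s : derivable h s 1 by have [] := hd s.
apply: (@ler0_derive1_nincry _ h T) => // [s|]; last first.
  exact: derivable_within_continuous.
by rewrite in_itv /= andbT derive1E => /dh0; have [_ ->] := hd s.
Qed.

Lemma cvg_expRN_scale (c : R) : 0 < c ->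
  expR (- (c * t)) @[t --> +oo] --> (0 : R).
Proof.
move=> c0.
apply: (@cvg_comp _ _ _ ( *%R c) (fun s => expR (- s))) (@cvgr_expR R).
by apply: gt0_cvgMry => //; exact: cvg_id.
Qed.

Lemma differential_inequality_decay (c : R) h dh g : 0 < c ->
  (forall t, is_derive t (1 : R) h (dh t)) ->
  (forall t, dh t <= - c * h t + g t) -> (forall t, 0 <= h t) ->
  g @ +oo --> (0 : R) -> h @ +oo --> (0 : R).
Proof.
move=> c0 hd dhle h0 g0; apply/cvgr0Pnorm_le => e e0.
have ce2 : 0 < c * (e / 2) by rewrite mulr_gt0 ?divr_gt0.
have [T [_ gT]] := cvgr0_norm_le _ g0 _ ce2.
pose k t := expR (c * t) * (h t - e / 2).
have kd t : is_derive t (1 : R) k (expR (c * t) * (c * (h t - e / 2) + dh t)).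
  have expd : is_derive t (1 : R) (fun t => expR (c * t)) (c * expR (c * t)).
    apply: trigger_derive; rewrite /GRing.scale /= ?mulr1 ?mulr0 ?addr0.
    by ring.
  by apply: trigger_derive; rewrite /GRing.scale /=; ring.
have knincr t : T + 1 <= t -> k t <= k (T + 1).
  apply: (is_derive_nincr kd) => s Ts; rewrite pmulr_rle0 ?expR_gt0 //.
  have /gT /ler_normlP[_ gs] : T < s by lra.
  have := dhle s; lra.
have kexp0 : k (T + 1) * expR (- (c * t)) @[t --> +oo] --> (0 : R).
  by rewrite -(mulr0 (k (T + 1))); apply: cvgMr; exact: cvg_expRN_scale.
near=> t; rewrite ger0_norm //.
have : k (T + 1) * expR (- (c * t)) <= e / 2.
  apply: le_trans (ler_norm _) _; near: t.
  by apply: (cvgr0_norm_le _ kexp0); rewrite divr_gt0.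
have : k t <= k (T + 1).
  by apply: knincr; near: t; apply: nbhs_pinfty_ge; rewrite num_real.
rewrite -(ler_pM2r (expR_gt0 (- (c * t)))) /k mulrAC -expRD subrr expR0 mul1r.
by move=> /le_trans h_le /h_le; lra.
Unshelve. all: by end_near. Qed.

End RealDecay.

Section ComplexParts.
Variable R : realType.
Local Notation C := R[i].
Local Notation Re := (@complex.Re R).
Local Notation Im := (@complex.Im R).
Implicit Types z c : C.

Lemma cReD z c : Re (z + c) = Re z + Re c.
Proof. by case: z; case: c. Qed.

Lemma cImD z c : Im (z + c) = Im z + Im c.
Proof. by case: z; case: c. Qed.

Lemma cReB z c : Re (z - c) = Re z - Re c.
Proof. by case: z; case: c. Qed.

Lemma cImB z c : Im (z - c) = Im z - Im c.
Proof. by case: z; case: c. Qed.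

Lemma cReM z c : Re (z * c) = Re z * Re c - Im z * Im c.
Proof. by case: z; case: c. Qed.

Lemma cImM z c : Im (z * c) = Re z * Im c + Im z * Re c.
Proof. by case: z; case: c. Qed.

Lemma Re_mulmxC m n p (P : 'M[R]_(m, n)) (Q : 'M[C]_(n, p)) :
  map_mx Re (mxC P *m Q) = P *m map_mx Re Q.
Proof.
apply/matrixP => i j; rewrite !mxE (big_morph Re cReD (erefl : Re 0 = 0)).
by apply: eq_bigr => k _; rewrite !mxE cReM /= mul0r subr0.
Qed.

Lemma Im_mulmxC m n p (P : 'M[R]_(m, n)) (Q : 'M[C]_(n, p)) :
  map_mx Im (mxC P *m Q) = P *m map_mx Im Q.
Proof.
apply/matrixP => i j; rewrite !mxE (big_morph Im cImD (erefl : Im 0 = 0)).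
by apply: eq_bigr => k _; rewrite !mxE cImM /= mul0r addr0.
Qed.

Lemma mx_Re_Im_eq0 m n (M : 'M[C]_(m, n)) :
  map_mx Re M = 0 -> map_mx Im M = 0 -> M = 0.
Proof.
move=> /matrixP ReM0 /matrixP ImM0; apply/matrixP => i j.
have := ReM0 i j; have := ImM0 i j; rewrite !mxE.
by case: (M i j) => x y /= -> ->.
Qed.

End ComplexParts.

Section ComplexDerivatives.
Variable R : realType.
Local Notation C := R[i].
Local Notation Re := (@complex.Re R).
Local Notation Im := (@complex.Im R).
Implicit Types (f df g dg : R -> C) (c z : C).

Definition has_cderiv f df : Prop := forall t,
  is_derive t (1 : R) (fun s => Re (f s)) (Re (df t)) /\
  is_derive t (1 : R) (fun s => Im (f s)) (Im (df t)).

Lemma eq_has_cderiv f df g dg :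
  f =1 g -> df =1 dg -> has_cderiv g dg -> has_cderiv f df.
Proof. by move=> /funext -> /funext ->. Qed.

Lemma has_cderiv_cst c : has_cderiv (fun=> c) (fun=> 0).
Proof. by move=> t; split; exact: is_derive_cst. Qed.

Lemma has_cderivD f df g dg : has_cderiv f df -> has_cderiv g dg ->
  has_cderiv (fun t => f t + g t) (fun t => df t + dg t).
Proof.
move=> fd gd t; have [Refd Imfd] := fd t; have [Regd Imgd] := gd t.
split; rewrite ?cReD ?cImD;
  [under eq_fun do rewrite cReD | under eq_fun do rewrite cImD];
  exact: is_deriveD.
Qed.

Lemma has_cderivMl c f df : has_cderiv f df ->
  has_cderiv (fun t => c * f t) (fun t => c * df t).
Proof.
move=> fd t; have [Refd Imfd] := fd t.
split; rewrite ?cReM ?cImM;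
  [under eq_fun do rewrite cReM | under eq_fun do rewrite cImM];
  by apply: trigger_derive; rewrite /GRing.scale /=; ring.
Qed.

Lemma has_cderiv_sum (I : Type) (s : seq I) (f df : I -> R -> C) :
  (forall i, has_cderiv (f i) (df i)) ->
  has_cderiv (fun t => \sum_(i <- s) f i t) (fun t => \sum_(i <- s) df i t).
Proof.
move=> fd; elim: s => [|i s IH].
  by apply: (eq_has_cderiv _ _ (has_cderiv_cst 0)) => t; rewrite big_nil.
by apply: (eq_has_cderiv _ _ (has_cderivD (fd i) IH)) => t; rewrite big_cons.
Qed.

Lemma sqrnormc_is_derive z f g : has_cderiv f (fun t => z * f t + g t) ->
  forall t, is_derive t (1 : R) (fun s => sqrnormc (f s))
    (2 * Re z * sqrnormc (f t)
       + 2 * (Re (f t) * Re (g t) + Im (f t) * Im (g t))).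
Proof.
move=> fd t; have [Refd Imfd] := fd t.
apply: trigger_derive; rewrite /GRing.scale /sqrnormc /=.
by case: z (f t) (g t) {Refd Imfd fd} => a b [u v] [p q] /=; ring.
Qed.

Lemma has_cderiv_stable_decay z f g : Re z < 0 ->
  has_cderiv f (fun t => z * f t + g t) -> g @ +oo --> (0 : C) ->
  f @ +oo --> (0 : C).
Proof.
move=> z0 fd /cvg0_sqrnormc g0; apply/cvg0_sqrnormc.
pose c := - Re z; have c0 : 0 < c by rewrite oppr_gt0.
apply: (differential_inequality_decay c0 (sqrnormc_is_derive fd)
  (g := fun t => c^-1 * sqrnormc (g t))) => [t|t|].
- (* AM-GM: [2 u p <= c u^2 + p^2 / c] in both components *)
  have amgm (u p : R) : 2 * (u * p) <= c * u ^+ 2 + c^-1 * p ^+ 2.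
    rewrite -subr_ge0; have -> : c * u ^+ 2 + c^-1 * p ^+ 2 - 2 * (u * p) =
      c^-1 * (c * u - p) ^+ 2 by field; rewrite gt_eqF.
    by rewrite mulr_ge0 ?sqr_ge0 // invr_ge0 ltW.
  have := amgm (Re (f t)) (Re (g t)); have := amgm (Im (f t)) (Im (g t)).
  rewrite /sqrnormc mulrDr [c^-1 * (_ + _)]mulrDr /c; lra.
- exact: sqrnormc_ge0.
by rewrite -(mulr0 c^-1); apply: cvgMr.
Qed.

Lemma has_cderiv_unstable_eq0 z f : 0 <= Re z ->
  has_cderiv f (fun t => z * f t) -> f @ +oo --> (0 : C) -> f 0 = 0.
Proof.
move=> z0 fd /cvg0_sqrnormc f0; apply/eqP; rewrite -sqrnormc_eq0.
have fd' : has_cderiv f (fun t => z * f t + 0) by move=> t; rewrite addr0.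
rewrite eq_le sqrnormc_ge0 andbT; apply: (cvgr_to_ge f0); near=> t.
rewrite -lerN2; apply: (is_derive_nincr (T := 0)
    (h := fun t => - sqrnormc (f t))
    (dh := fun t => - (2 * Re z * sqrnormc (f t)))) => [s|s _|].
- apply: is_deriveN; apply: trigger_derive (sqrnormc_is_derive fd' s) _.
  by rewrite /= !mulr0 !addr0 mulr0 addr0.
- by rewrite oppr_le0 !mulr_ge0 // sqrnormc_ge0.
by near: t; apply: nbhs_pinfty_ge; rewrite num_real.
Unshelve. all: by end_near. Qed.

End ComplexDerivatives.

Section MatrixDerivatives.
Variable R : realType.
Local Notation C := R[i].

Definition has_cderivmx m n (X dX : R -> 'M[C]_(m, n)) : Prop :=
  forall i j, has_cderiv (fun t => X t i j) (fun t => dX t i j).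

Lemma eq_has_cderivmx m n (X dX Y dY : R -> 'M[C]_(m, n)) :
  X =1 Y -> dX =1 dY -> has_cderivmx Y dY -> has_cderivmx X dX.
Proof. by move=> /funext -> /funext ->. Qed.

Lemma has_cderivmxB m n (X dX Y dY : R -> 'M[C]_(m, n)) :
  has_cderivmx X dX -> has_cderivmx Y dY ->
  has_cderivmx (fun t => X t - Y t) (fun t => dX t - dY t).
Proof.
move=> Xd Yd i j; apply: eq_has_cderiv
  (has_cderivD (Xd i j) (has_cderivMl (-1) (Yd i j))) => t;
  by rewrite !mxE mulN1r.
Qed.

Lemma has_cderivmxMl m n p (P : 'M[C]_(m, n)) (X dX : R -> 'M[C]_(n, p)) :
  has_cderivmx X dX -> has_cderivmx (fun t => P *m X t) (fun t => P *m dX t).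
Proof.
move=> Xd i j; apply: eq_has_cderiv (has_cderiv_sum (index_enum _)
  (fun k => has_cderivMl (P i k) (Xd k j))) => t; exact: mxE.
Qed.

Lemma has_cderivmxMr m n p (P : 'M[C]_(n, p)) (X dX : R -> 'M[C]_(m, n)) :
  has_cderivmx X dX -> has_cderivmx (fun t => X t *m P) (fun t => dX t *m P).
Proof.
move=> Xd i j; apply: eq_has_cderiv (has_cderiv_sum (index_enum _)
  (fun k => has_cderivMl (P k j) (Xd i k))) => t;
  by rewrite mxE; apply: eq_bigr => k _; rewrite mulrC.
Qed.

Lemma has_cderivmxC m n (X dX : R -> 'M[R]_(m, n)) :
  has_cderivmx (fun t => mxC (X t)) (fun t => mxC (dX t)) <-> has_deriv X dX.
Proof.
have entryE (Y : R -> 'M[R]_(m, n)) i j : (fun t => mxC (Y t) i j) =1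
  (fun t => (Y t i j)%:C%C) by move=> t; rewrite mxE.
split=> [Xd t i j|Xd i j].
  have [] // := eq_has_cderiv (fsym (entryE X i j)) (fsym (entryE dX i j))
    (Xd i j) t.
apply: eq_has_cderiv (entryE X i j) (entryE dX i j) _ => t.
by split; [exact: Xd | exact: is_derive_cst].
Qed.

Lemma has_derivMl m n p (P : 'M[R]_(m, n)) (X dX : R -> 'M[R]_(n, p)) :
  has_deriv X dX -> has_deriv (fun t => P *m X t) (fun t => P *m dX t).
Proof.
move=> /has_cderivmxC Xd; apply/has_cderivmxC.
by apply: eq_has_cderivmx (has_cderivmxMl (mxC P) Xd) => t; rewrite map_mxM.
Qed.

Lemma has_derivMr m n p (P : 'M[R]_(n, p)) (X dX : R -> 'M[R]_(m, n)) :
  has_deriv X dX -> has_deriv (fun t => X t *m P) (fun t => dX t *m P).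
Proof.
move=> /has_cderivmxC Xd; apply/has_cderivmxC.
by apply: eq_has_cderivmx (has_cderivmxMr (mxC P) Xd) => t; rewrite map_mxM.
Qed.

Lemma eq_has_deriv m n (X dX Y dY : R -> 'M[R]_(m, n)) :
  X =1 Y -> dX =1 dY -> has_deriv Y dY -> has_deriv X dX.
Proof. by move=> /funext -> /funext ->. Qed.

Lemma has_deriv_usubmx m1 m2 n (X dX : R -> 'M[R]_(m1 + m2, n)) :
  has_deriv X dX -> has_deriv (fun t => usubmx (X t)) (fun t => usubmx (dX t)).
Proof.
by move=> Xd t i j; rewrite mxE; under eq_fun do rewrite mxE; exact: Xd.
Qed.

Lemma has_deriv_dsubmx m1 m2 n (X dX : R -> 'M[R]_(m1 + m2, n)) :
  has_deriv X dX -> has_deriv (fun t => dsubmx (X t)) (fun t => dsubmx (dX t)).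
Proof.
by move=> Xd t i j; rewrite mxE; under eq_fun do rewrite mxE; exact: Xd.
Qed.

Lemma tends_to_zeroC m n (X : R -> 'M[R]_(m, n)) :
  mxC (X t) @[t --> +oo] --> (0 : 'M[C]_(m, n)) <-> tends_to_zero X.
Proof.
rewrite cvg_mx0P; split=> X0 i j; have := X0 i j.
  by under eq_fun do rewrite mxE; move/cvg0_real_complex.
by under [in X in _ -> X]eq_fun do rewrite mxE; move/cvg0_real_complex.
Qed.

End MatrixDerivatives.

Section MatrixDecay.
Variable R : realType.
Local Notation C := R[i].
Local Notation Re := (@complex.Re R).

Definition stable_mx n (M : 'M[C]_n) : Prop :=
  forall z, eigenvalue M z -> Re z < 0.

Lemma has_cderivmx_stable_decay m n z (X G : R -> 'M[C]_(m, n)) : Re z < 0 ->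
  has_cderivmx X (fun t => z *: X t + G t) ->
  G @ +oo --> (0 : 'M[C]_(m, n)) -> X @ +oo --> (0 : 'M[C]_(m, n)).
Proof.
move=> z0 Xd /cvg_mx0P G0; apply/cvg_mx0P => i j.
apply: (has_cderiv_stable_decay z0 _ (G0 i j)).
by apply: eq_has_cderiv (Xd i j) => // t; rewrite !mxE.
Qed.

Lemma stable_factors_decay m n p (M : 'M[C]_n) (X G : R -> 'M[C]_(n, p))
    (zs : seq C) (P : 'M[C]_(m, n)) :
  has_cderivmx X (fun t => M *m X t + G t) -> G @ +oo --> (0 : 'M[C]_(n, p)) ->
  (forall z, z \in zs -> Re z < 0) -> P *m mxprodXsubC M zs = 0 ->
  P *m X t @[t --> +oo] --> (0 : 'M[C]_(m, p)).
Proof.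
move=> Xd G0; elim: zs P => [|z zs IH] P zs0.
  rewrite mxprodXsubC_nil mulmx1 => ->; under eq_fun do rewrite mul0mx.
  exact: cvg_cst.
rewrite mxprodXsubC_cons mulmxA => /IH PMz0.
apply: (has_cderivmx_stable_decay
  (G := fun t => P *m (M - z%:M) *m X t + P *m G t) (zs0 z (mem_head _ _))).
  apply: eq_has_cderivmx (has_cderivmxMl P Xd) => // t.
  rewrite mulmxBr mul_mx_scalar mulmxBl -scalemxAl addrA subrKC.
  by rewrite mulmxDr mulmxA.
apply: cvg0D; last exact: cvg0_mulmxl.
by apply: PMz0 => w wzs; apply: zs0; rewrite inE wzs orbT.
Qed.

Lemma stable_mx_decay n p (M : 'M[C]_n) (X G : R -> 'M[C]_(n, p)) :
  stable_mx M -> has_cderivmx X (fun t => M *m X t + G t) ->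
  G @ +oo --> (0 : 'M[C]_(n, p)) -> X @ +oo --> (0 : 'M[C]_(n, p)).
Proof.
move=> stableM Xd G0; suff : 1%:M *m X t @[t --> +oo] --> (0 : 'M[C]_(n, p)).
  by under eq_fun do rewrite mul1mx.
apply: (stable_factors_decay Xd G0 (zs := spectrum M)) => [z|].
  by rewrite mem_spectrum; exact: stableM.
by rewrite mxprodXsubC_spectrum mulmx0.
Qed.

Lemma sylvester_decay n N p (A : 'M[C]_n) (L : 'M[C]_N)
    (E G : R -> 'M[C]_(n, N)) (zs : seq C) (c : 'M[C]_(N, p)) :
  has_cderivmx E (fun t => A *m E t - E t *m L + G t) ->
  G @ +oo --> (0 : 'M[C]_(n, N)) ->
  (forall z w, z \in zs -> eigenvalue A w -> Re w < Re z) ->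
  mxprodXsubC L zs *m c = 0 -> E t *m c @[t --> +oo] --> (0 : 'M[C]_(n, p)).
Proof.
move=> Ed G0; elim: zs c => [|z zs IH] c zs_right.
  rewrite mxprodXsubC_nil mul1mx => ->; under eq_fun do rewrite mulmx0.
  exact: cvg_cst.
rewrite mxprodXsubC_consr -mulmxA => /IH ELz0.
apply: (@stable_mx_decay _ _ (A - z%:M) _
   (fun t => - (E t *m ((L - z%:M) *m c)) + G t *m c)).
- move=> w; rewrite eigenvalue_sub_scalar => /(zs_right z _ (mem_head _ _)).
  by rewrite cReD; lra.
- apply: eq_has_cderivmx (has_cderivmxMr c Ed) => // t.
  rewrite mulmxDl !mulmxBl mul_scalar_mx addrA; congr (_ + _).
  rewrite mul_scalar_mx mulmxBr -scalemxAr !mulmxA opprB addrA.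
  by rewrite -[_ - _ + _]addrA [- _ + _]addrC subrr addr0.
apply: cvg0D; last exact: cvg0_mulmxr.
by apply/cvg0N/ELz0 => w u wzs; apply: zs_right; rewrite inE wzs orbT.
Qed.

End MatrixDecay.

(** * Graph Laplacians *)

Section Laplacian.
Variables (R : realType) (N : nat) (a : 'M[R]_N).
Local Notation C := R[i].
Local Notation Re := (@complex.Re R).
Local Notation Im := (@complex.Im R).
Hypotheses (adj : adjacency a) (tree : has_spanning_tree a).
Local Notation L := (laplacian a).

Lemma mulmx_laplacian (v : 'cV[R]_N) i :
  (L *m v) i 0 = \sum_j a i j * (v i 0 - v j 0).
Proof.
have [_ a0] := adj; rewrite mxE (bigD1 i) //= mxE eqxx [RHS](bigD1 i) //=.
rewrite subrr mulr0 add0r [\sum_(k < N) a i k](bigD1 i) //= a0 add0r.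
rewrite mulr_suml -big_split /=; apply: eq_bigr => j ji.
by rewrite mxE eq_sym (negbTE ji) mulrBr mulNr.
Qed.

Lemma laplacian_argmax_ge0 (v : 'cV[R]_N) i :
  (forall k, v k 0 <= v i 0) -> 0 <= (L *m v) i 0.
Proof.
move=> vi; rewrite mulmx_laplacian; apply: sumr_ge0 => j _.
by rewrite mulr_ge0 ?subr_ge0 //; case: adj.
Qed.

Lemma exists_argmax (v : 'cV[R]_N) : exists i, forall k, v k 0 <= v i 0.
Proof.
have [r _] := tree; pose entry i := v i 0.
by have [i _ imax] := @Order.TotalTheory.arg_maxP _ _ _ r xpredT entry isT;
  exists i => k; exact: imax.
Qed.

Lemma laplacian_const_eq0 (v : 'cV[R]_N) c : L *m v = const_mx c -> c = 0.
Proof.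
move=> Lv; apply/eqP; rewrite eq_le; apply/andP; split.
  have [i /laplacian_argmax_ge0] := exists_argmax (- v).
  by rewrite mulmxN Lv !mxE oppr_ge0.
by have [i /laplacian_argmax_ge0] := exists_argmax v; rewrite Lv mxE.
Qed.

Lemma harmonic_max_at_root (v : 'cV[R]_N) r :
  (forall i, connect (edge a) r i) -> L *m v = 0 -> forall k, v k 0 <= v r 0.
Proof.
move=> reach Lv0; have [i vi] := exists_argmax v.
have /connectP[p pth ip] := reach i; rewrite ip in vi.
elim: p r pth vi {reach ip} => [|x p IH] r //= /andP[rx pth] vi k.
have vx := IH _ pth vi; apply: le_trans (vx k) _.
have := mulmx_laplacian v x; rewrite Lv0 mxE => /esym/eqP.
rewrite psumr_eq0 => [/allP/(_ r)|j _]; last first.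
  by rewrite mulr_ge0 ?subr_ge0 //; case: adj.
rewrite mem_index_enum => /(_ isT) /=; rewrite mulf_eq0 gt_eqF //=.
by rewrite subr_eq0 => /eqP ->.
Qed.

Lemma harmonic_const (v : 'cV[R]_N) : L *m v = 0 -> forall i j, v i 0 = v j 0.
Proof.
have [r reach] := tree; move=> Lv0.
suff vr i : v i 0 = v r 0 by move=> i j; rewrite !vr.
apply/eqP; rewrite eq_le (harmonic_max_at_root reach) //=.
have := @harmonic_max_at_root (- v) r reach.
by rewrite mulmxN Lv0 oppr0 => /(_ erefl i); rewrite !mxE lerN2.
Qed.

Lemma laplacian_ker_sqr (v : 'cV[R]_N) : L *m (L *m v) = 0 -> L *m v = 0.
Proof.
have [r _] := tree; move=> /harmonic_const Lv_const.
have LvE : L *m v = const_mx ((L *m v) r 0).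
  by apply/colP => i; rewrite [RHS]mxE.
by rewrite LvE (laplacian_const_eq0 LvE).
Qed.

Lemma complex_harmonic_const (v : 'cV[C]_N) :
  mxC L *m v = 0 -> forall i j, v i 0 = v j 0.
Proof.
move=> Lv0 i j; apply/eqP; rewrite eq_complex.
have := @harmonic_const (map_mx Re v); rewrite -Re_mulmxC Lv0 map_mx0.
move=> /(_ erefl i j); rewrite !mxE => ->.
have := @harmonic_const (map_mx Im v); rewrite -Im_mulmxC Lv0 map_mx0.
by move=> /(_ erefl i j); rewrite !mxE => ->; rewrite !eqxx.
Qed.

Lemma complex_laplacian_ker_sqr (v : 'cV[C]_N) :
  mxC L *m (mxC L *m v) = 0 -> mxC L *m v = 0.
Proof.
move=> LLv0; apply: mx_Re_Im_eq0; rewrite ?Re_mulmxC ?Im_mulmxC;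
  apply: laplacian_ker_sqr; rewrite -?Re_mulmxC -?Im_mulmxC LLv0;
  by apply/colP => i; rewrite !mxE.
Qed.

Lemma laplacian_eigenvalue z : eigenvalue (mxC L) z -> z = 0 \/ 0 < Re z.
Proof.
have [a_ge0 a_diag] := adj; move=> /gershgorin_disc[r].
pose d := \sum_k a r k.
have -> : mxC L r r = d%:C%C by rewrite !mxE eqxx.
have -> : \sum_(j | j != r) `|mxC L r j| = d%:C%C.
  rewrite rmorph_sum [RHS](bigD1 r) //= a_diag add0r; apply: eq_bigr => j ji.
  by rewrite !mxE eq_sym (negbTE ji) rmorphN normrN ger0_norm // ler0c.
have d0 : 0 <= d by rewrite sumr_ge0.
rewrite normc_def lecR -[leRHS]ger0_norm // -sqrtr_sqr ler_sqrt ?sqr_ge0 //.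
rewrite cReB cImB /= subr0; have [|x0] := ltP 0 (Re z); first by right.
move=> disc; left; apply/eqP; rewrite -sqrnormc_eq0 eq_le sqrnormc_ge0 andbT.
have : d * Re z <= 0 by rewrite mulr_ge0_le0.
by rewrite /sqrnormc; lra.
Qed.

Definition nonzero_spectrum : seq C := [seq z <- spectrum (mxC L) | z != 0].

Lemma nonzero_spectrum_gt0 z : z \in nonzero_spectrum -> 0 < Re z.
Proof.
rewrite mem_filter mem_spectrum => /andP[/eqP z0 /laplacian_eigenvalue].
by case.
Qed.

Lemma complex_laplacian_ker_iter zs (v : 'cV[C]_N) :
  all (pred1 0) zs -> mxprodXsubC (mxC L) zs *m v = 0 -> mxC L *m v = 0.
Proof.
elim: zs v => [|z zs IH] v.
  by rewrite mxprodXsubC_nil mul1mx => _ ->; rewrite mulmx0.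
move=> /= /andP[/eqP -> zs0]; rewrite mxprodXsubC_consr raddf0 subr0 -mulmxA.
by move=> /(IH _ zs0)/complex_laplacian_ker_sqr.
Qed.

(* Since [ker L^2 = ker L] is spanned by the constant vector, the product of the
   factors [L - z] with [z != 0] has constant columns. *)
Lemma nonzero_spectrum_annihilator i j :
  mxprodXsubC (mxC L)^T nonzero_spectrum *m (delta_mx i 0 - delta_mx j 0)
    = 0 :> 'cV[C]_N.
Proof.
rewrite mxprodXsubC_tr; apply/colP => k; rewrite mulmxBr -!colE !mxE.
set Q := mxprodXsubC _ _; suff : Q i k = Q j k by move=> ->; rewrite subrr.
have /(_ i j) : forall i j, col k Q i 0 = col k Q j 0.
  apply/complex_harmonic_const/(@complex_laplacian_ker_iter
    [seq z <- spectrum (mxC L) | pred1 0 z]); first exact: filter_all.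
  by rewrite colE mulmxA mxprodXsubC_filter_spectrum mul0mx.
by rewrite !mxE.
Qed.

End Laplacian.

(** * Networks in matrix form *)

Section Stack.
Variable R : realType.

Definition stack n N (x : 'I_N -> 'cV[R]_n) : 'M[R]_(n, N) :=
  \matrix_(k, i) x i k 0.

Lemma stackD n N (x y : 'I_N -> 'cV[R]_n) :
  stack (fun i => x i + y i) = stack x + stack y.
Proof. by apply/matrixP => k i; rewrite !mxE. Qed.

Lemma stackM m n N (P : 'M[R]_(m, n)) (x : 'I_N -> 'cV[R]_n) :
  stack (fun i => P *m x i) = P *m stack x.
Proof.
by apply/matrixP => k i; rewrite !mxE; apply: eq_bigr => j _; rewrite mxE.
Qed.

Lemma stack_lincomb n N (L : 'M[R]_N) (x : 'I_N -> 'cV[R]_n) :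
  stack (fun i => \sum_j L i j *: x j) = stack x *m L^T.
Proof.
apply/matrixP => k i; rewrite !mxE summxE.
by apply: eq_bigr => j _; rewrite !mxE mulrC.
Qed.

Lemma stack_scale n N (v : 'cV[R]_N) (u : 'cV[R]_n) :
  stack (fun i => v i 0 *: u) = u *m v^T.
Proof. by apply/matrixP => k i; rewrite !mxE big_ord1 !mxE mulrC. Qed.

Lemma has_deriv_stack n N (x dx : 'I_N -> R -> 'cV[R]_n) :
  has_deriv (fun t => stack (x^~ t)) (fun t => stack (dx^~ t)) <->
  forall i, has_deriv (x i) (dx i).
Proof.
split=> [xd i t k l|xd t k i].
  have := xd t k i; rewrite mxE ord1.
  by under eq_fun do rewrite mxE.
by rewrite mxE; under eq_fun do rewrite mxE; exact: xd.
Qed.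

Section ClosedLoop.
Variables (n nc q N : nat) (A : 'M[R]_n) (B : 'cV[R]_n) (C : 'rV[R]_n).
Variables (Ac : 'M[R]_nc) (Bc : 'cV[R]_nc) (Ec : 'M[R]_(nc, q)).
Variables (Fc : 'rV[R]_nc) (G1 : 'M[R]_1) (G2 : 'rV[R]_q) (Hc : 'M[R]_(q, nc)).
Variable a : 'M[R]_N.
Local Notation Lt := (laplacian a)^T.

Lemma closed_loopP (x : 'I_N -> R -> 'cV[R]_n) (xc : 'I_N -> R -> 'cV[R]_nc) :
  let X t := stack (x^~ t) in let Xc t := stack (xc^~ t) in
  closed_loop A B C Ac Bc Ec Fc G1 G2 Hc a x xc <->
  has_deriv X (fun t => A *m X t + B *m
    (Fc *m Xc t + G1 *m (C *m X t *m Lt) + G2 *m (Hc *m Xc t *m Lt))) /\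
  has_deriv Xc (fun t => Ac *m Xc t
    + Bc *m (C *m X t *m Lt) + Ec *m (Hc *m Xc t *m Lt)).
Proof.
move=> X Xc; pose zeta t i := \sum_j laplacian a i j *: (C *m x j t).
pose zetah t i := \sum_j laplacian a i j *: (Hc *m xc j t).
pose u t i := Fc *m xc i t + G1 *m zeta t i + G2 *m zetah t i.
have zetaE t : stack (zeta t) = C *m X t *m Lt by rewrite stack_lincomb stackM.
have zetahE t : stack (zetah t) = Hc *m Xc t *m Lt.
  by rewrite stack_lincomb stackM.
have <- : (fun t => stack (fun i => A *m x i t + B *m u t i)) = (fun t =>
    A *m X t + B *m (Fc *m Xc t + G1 *m (C *m X t *m Lt)
      + G2 *m (Hc *m Xc t *m Lt))).
  by apply/funext => t; rewrite !(stackD, stackM) zetaE zetahE.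
have <- : (fun t => stack (fun i =>
      Ac *m xc i t + Bc *m zeta t i + Ec *m zetah t i)) = (fun t =>
    Ac *m Xc t + Bc *m (C *m X t *m Lt) + Ec *m (Hc *m Xc t *m Lt)).
  by apply/funext => t; rewrite !(stackD, stackM) zetaE zetahE.
rewrite (has_deriv_stack x (fun i t => A *m x i t + B *m u t i)).
rewrite (has_deriv_stack xc (fun i t =>
  Ac *m xc i t + Bc *m zeta t i + Ec *m zetah t i)).
by split=> [cl|[xd xcd] i]; [split=> i; have [] := cl i | split].
Qed.

End ClosedLoop.

Definition synchronizing n nc q (A : 'M[R]_n) (B : 'cV[R]_n) (C : 'rV[R]_n)
    (Ac : 'M[R]_nc) (Bc : 'cV[R]_nc) (Ec : 'M[R]_(nc, q)) (Fc : 'rV[R]_nc)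
    (G1 : 'M[R]_1) (G2 : 'rV[R]_q) (Hc : 'M[R]_(q, nc)) : Prop :=
  forall (N : nat) (a : 'M[R]_N), adjacency a -> has_spanning_tree a ->
  forall (x : 'I_N -> R -> 'cV[R]_n) (xc : 'I_N -> R -> 'cV[R]_nc),
    closed_loop A B C Ac Bc Ec Fc G1 G2 Hc a x xc ->
  forall i j : 'I_N, tends_to_zero (fun t => x i t - x j t).

End Stack.

(** * The observer-based protocol *)

Section Observer.
Variables (R : realType) (n N p : nat).
Local Notation C := R[i].
Local Notation Re := (@complex.Re R).
Variables (A BF KC : 'M[C]_n) (Lt : 'M[C]_N) (zs : seq C) (c : 'M[C]_(N, p)).
Variables X Xh Chi : R -> 'M[C]_(n, N).
Hypothesis Xd : has_cderivmx X (fun t => A *m X t + BF *m Chi t).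
Hypothesis Xhd : has_cderivmx Xh (fun t =>
  (A + KC) *m Xh t - KC *m X t *m Lt + BF *m Chi t *m Lt).
Hypothesis Chid : has_cderivmx Chi (fun t =>
  Xh t + (A + BF) *m Chi t - Chi t *m Lt).
Hypotheses (stable_BF : stable_mx (A + BF)) (stable_KC : stable_mx (A + KC)).
Hypothesis eigA : forall w, eigenvalue A w -> Re w <= 0.
Hypothesis zs_gt0 : forall z, z \in zs -> 0 < Re z.
Hypothesis Lt_zs : mxprodXsubC Lt zs *m c = 0.

Lemma observer_error_decay :
  X t *m Lt - Xh t @[t --> +oo] --> (0 : 'M[C]_(n, N)).
Proof.
apply: (stable_mx_decay stable_KC (G := fun=> 0)); last exact: cvg_cst.
apply: eq_has_cderivmx (has_cderivmxB (has_cderivmxMr Lt Xd) Xhd) => // t.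
rewrite addr0 mulmxBr !mulmxDl !mulmxA.
by apply/matrixP => i j; rewrite !mxE; ring.
Qed.

Lemma tracking_error_decay :
  (X t - Chi t) *m c @[t --> +oo] --> (0 : 'M[C]_(n, p)).
Proof.
apply: (sylvester_decay (A := A) (zs := zs) _ observer_error_decay) Lt_zs.
  apply: eq_has_cderivmx (has_cderivmxB Xd Chid) => // t.
  rewrite mulmxBr mulmxBl mulmxDl.
  by apply/matrixP => i j; rewrite !mxE; ring.
by move=> z w /zs_gt0 z0 /eigA w0; apply: le_lt_trans z0.
Qed.

Lemma observer_state_decay : X t *m c @[t --> +oo] --> (0 : 'M[C]_(n, p)).
Proof.
apply: (stable_mx_decay stable_BF
  (G := fun t => - (BF *m ((X t - Chi t) *m c)))); last first.
  by apply/cvg0N/cvg0_mulmxl/tracking_error_decay.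
apply: eq_has_cderivmx (has_cderivmxMr c Xd) => // t.
rewrite mulmxBl mulmxBr !mulmxDl !mulmxA.
by apply/matrixP => i j; rewrite !mxE; ring.
Qed.

End Observer.

Section Sufficiency.
Variables (R : realType) (n : nat) (A : 'M[R]_n) (B : 'cV[R]_n) (C : 'rV[R]_n).
Variables (F : 'rV[R]_n) (K : 'cV[R]_n).

Lemma observer_protocol_synchronizing :
  hurwitz (A + B *m F) -> hurwitz (A + K *m C) -> eig_closed_lhp A ->
  synchronizing A B C (block_mx (A + K *m C) 0 1%:M (A + B *m F))
    (col_mx (- K) 0) (col_mx (B *m F) (- 1%:M)) (row_mx 0 F) 0 0
    (row_mx 0 1%:M : 'M[R]_(n, n + n)).
Proof.
move=> hF hK hA N a adj tree x xc /closed_loopP[].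
set Lt := (laplacian a)^T.
pose X t := stack (x^~ t); pose Xc t := stack (xc^~ t).
pose Xh t := usubmx (Xc t); pose Chi t := dsubmx (Xc t).
have XcE t : stack (xc^~ t) = col_mx (Xh t) (Chi t) by rewrite vsubmxK.
move=> Xd Xcd i j; apply/tends_to_zeroC.
pose c : 'cV[R]_N := delta_mx i 0 - delta_mx j 0.
have <- : (fun t => mxC (X t) *m mxC c) = (fun t => mxC (x i t - x j t)).
  apply/funext => t; rewrite -map_mxM mulmxBr -!colE; congr map_mx.
  by apply/colP => k; rewrite !mxE.
apply: (@observer_state_decay _ _ _ _ (mxC A) (mxC (B *m F)) (mxC (K *m C))
  (mxC Lt) (nonzero_spectrum a) (mxC c) _ (fun t => mxC (Xh t))
  (fun t => mxC (Chi t))).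
- apply: eq_has_cderivmx ((has_cderivmxC _ _).2 Xd) => // t.
  rewrite XcE !mul_row_col !mul0mx !addr0 add0r mulmxA.
  by rewrite map_mxD !(map_mxM (real_complex R)).
- apply: eq_has_cderivmx ((has_cderivmxC _ _).2 (has_deriv_usubmx Xcd)) => // t.
  rewrite XcE mul_block_col mul_row_col !mul_col_mx !add_col_mx col_mxKu.
  rewrite !mul0mx !addr0 add0r mul1mx mulNmx !mulmxA.
  by rewrite !(map_mxD, map_mxN, map_mxM).
- apply: eq_has_cderivmx ((has_cderivmxC _ _).2 (has_deriv_dsubmx Xcd)) => // t.
  rewrite XcE mul_block_col mul_row_col !mul_col_mx !add_col_mx col_mxKd.
  rewrite !mul0mx !addr0 add0r !mul1mx mulNmx mul1mx.
  by rewrite !(map_mxD, map_mxN, map_mxM).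
- by move=> z; rewrite -map_mxD; exact: hF.
- by move=> z; rewrite -map_mxD; exact: hK.
- exact: hA.
- by move=> z; exact: nonzero_spectrum_gt0.
by rewrite -map_trmx map_mxB !map_delta_mx nonzero_spectrum_annihilator.
Qed.

End Sufficiency.

(** * Existence of solutions *)

Section LinearFlow.
Variables (R : realType) (m : nat) (M : 'M[R]_m).
Implicit Type x : 'cV[R]_m.

Definition exp_mx_coeff x (i : 'I_m) (k : nat) : R :=
  iter k (mulmx M) x i 0 / k`!%:R.

Lemma mx_norm_iter_mulmx x k :
  `|iter k (mulmx M) x| <= (m%:R * `|M|) ^+ k * `|x|.
Proof.
elim: k => [|k IH] /=; first by rewrite mul1r.
apply: le_trans (mx_norm_mulmx _ _) _; rewrite exprS -[leRHS]mulrA.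
by rewrite ler_wpM2l // mulr_ge0.
Qed.

Lemma is_cvg_exp_mx x i t : cvgn (pseries (exp_mx_coeff x i) t).
Proof.
pose D := m%:R * `|M| : R; have D0 : 0 <= D by rewrite mulr_ge0.
apply: normed_cvg; apply: (series_le_cvg (v_ := `|x| *: exp_coeff (D * `|t|))).
- by move=> k; rewrite normr_ge0.
- by move=> k; rewrite mulr_ge0 // divr_ge0 // exprn_ge0 // mulr_ge0.
- move=> k; rewrite /= /exp_mx_coeff !normrM normfV normr_nat normrX mulrAC.
  rewrite -[X in _ <= X]/(`|x| * ((D * `|t|) ^+ k / k`!%:R)) exprMn !mulrA.
  rewrite ler_wpM2r ?invr_ge0 // ler_wpM2r ?exprn_ge0 // [leRHS]mulrC.
  exact/le_trans/mx_norm_iter_mulmx/mx_entry_le_norm.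
by apply: is_cvg_seriesZ; exact: is_cvg_series_exp_coeff.
Qed.

Lemma pseries_diffs_exp_mx x i :
  pseries_diffs (exp_mx_coeff x i) = exp_mx_coeff (M *m x) i.
Proof.
apply/funext => k; rewrite /pseries_diffs /exp_mx_coeff iterSr factS natrM.
by rewrite invfM mulrCA [_%:R * _]mulrA mulfV ?mul1r // pnatr_eq0.
Qed.

Definition linear_flow x (t : R) : 'cV[R]_m :=
  \col_i limn (pseries (exp_mx_coeff x i) t).

Lemma linear_flow0 x : linear_flow x 0 = x.
Proof.
apply/colP => i; rewrite mxE; apply: cvg_lim => //.
apply: cvg_near_cst; exists 1%N => // -[|k] //= _.
rewrite /pseries /series /= big_nat_recl // expr0 mulr1 big1_seq ?addr0.
  by rewrite /exp_mx_coeff fact0 divr1.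
by move=> j _; rewrite expr0n mulr0.
Qed.

Lemma linear_flow_mulmx x t : linear_flow (M *m x) t = M *m linear_flow x t.
Proof.
apply/colP => i; rewrite !mxE; apply: cvg_lim => //.
have -> : pseries (exp_mx_coeff (M *m x) i) t =
    (fun k => \sum_j M i j * pseries (exp_mx_coeff x j) t k).
  apply/funext => k; rewrite /pseries /series /=.
  under [RHS]eq_bigr do rewrite mulr_sumr.
  rewrite exchange_big /=; apply: eq_bigr => l _.
  rewrite /exp_mx_coeff -iterSr /= mxE !mulr_suml; apply: eq_bigr => j _.
  by rewrite !mulrA.
apply: cvg_big => [|j _]; first exact: add_continuous.
by apply: cvgMr; rewrite mxE; exact: is_cvg_exp_mx.
Qed.

Lemma has_deriv_linear_flow x :
  has_deriv (linear_flow x) (fun t => M *m linear_flow x t).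
Proof.
move=> t i j; rewrite ord1 -linear_flow_mulmx.
under eq_fun do rewrite mxE; rewrite mxE -pseries_diffs_exp_mx.
apply: (@pseries_snd_diffs _ _ (`|t| + 1)); rewrite ?pseries_diffs_exp_mx;
  try exact: is_cvg_exp_mx.
by rewrite [ltRHS]ger0_norm ?ltrDl // addr_ge0.
Qed.

End LinearFlow.

(** * Rows along which all solutions decay *)

Section DecayingRows.
Variables (R : realType) (m : nat) (M : 'M[R]_m).
Local Notation C := R[i].
Local Notation Re := (@complex.Re R).
Implicit Types (r : 'rV[C]_m) (z : C).

Definition decaying r : Prop := forall x : R -> 'cV[R]_m,
  has_deriv x (fun t => M *m x t) ->
  r *m mxC (x t) @[t --> +oo] --> (0 : 'M[C]_1).

Lemma decaying_factor r z : decaying r -> decaying (r *m (mxC M - z%:M)).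
Proof.
move=> r_decays x xd.
have -> : (fun t => r *m (mxC M - z%:M) *m mxC (x t)) =
    (fun t => r *m mxC (M *m x t) - z%:M *m (r *m mxC (x t))).
  apply/funext => t; rewrite mulmxBr mulmxBl map_mxM mulmxA.
  by rewrite mul_mx_scalar mul_scalar_mx scalemxAl.
apply: cvg0D; first exact: r_decays (has_derivMl M xd).
exact/cvg0N/cvg0_mulmxl/r_decays.
Qed.

Lemma decaying_mxprodXsubC r zs :
  decaying r -> decaying (r *m mxprodXsubC (mxC M) zs).
Proof.
elim: zs r => [|z zs IH] r r_decays; first by rewrite mxprodXsubC_nil mulmx1.
by rewrite mxprodXsubC_cons mulmxA; apply: IH; exact: decaying_factor.
Qed.

Lemma decaying_unstable_eigenrow r z : 0 <= Re z -> decaying r ->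
  r *m mxC M = z *: r -> r = 0.
Proof.
move=> z0 r_decays rM; apply/rowP => j; rewrite [RHS]mxE.
have xd := has_deriv_linear_flow M (delta_mx j 0).
have /cvg_mx0P/(_ 0 0) rx0 := r_decays _ xd.
pose x := linear_flow M (delta_mx j 0).
have rxd : has_cderiv (fun t => (r *m mxC (x t)) 0 0)
    (fun t => z * (r *m mxC (x t)) 0 0).
  move/has_cderivmxC: xd => /(has_cderivmxMl r)/(_ 0 0).
  apply: eq_has_cderiv => // t.
  by rewrite map_mxM mulmxA rM -scalemxAl [RHS]mxE.
have := has_cderiv_unstable_eq0 z0 rxd rx0.
by rewrite /x linear_flow0 map_delta_mx -colE mxE.
Qed.

Lemma decaying_unstable_factors_eq0 r zs : (forall z, z \in zs -> 0 <= Re z) ->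
  decaying r -> r *m mxprodXsubC (mxC M) zs = 0 -> r = 0.
Proof.
elim: zs r => [|z zs IH] r zs_ge0 r_decays.
  by rewrite mxprodXsubC_nil mulmx1.
rewrite mxprodXsubC_cons mulmxA => /IH rMz0.
apply: (@decaying_unstable_eigenrow _ z) => //; first exact/zs_ge0/mem_head.
apply/eqP; rewrite -subr_eq0 -mul_mx_scalar -mulmxBr rMz0 // => [w wzs|].
  by apply: zs_ge0; rewrite inE wzs orbT.
exact: decaying_factor.
Qed.

Definition stable_spectrum : seq C := [seq z <- spectrum (mxC M) | Re z < 0].

Lemma stable_spectrum_lt0 z : z \in stable_spectrum -> Re z < 0.
Proof. by rewrite mem_filter => /andP[]. Qed.

Lemma size_stable_spectrum : (size stable_spectrum <= m)%N.
Proof. by rewrite size_filter -[leqRHS](size_spectrum (mxC M)) count_size. Qed.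

Lemma decaying_stable_factors r :
  decaying r -> r *m mxprodXsubC (mxC M) stable_spectrum = 0.
Proof.
move=> r_decays; apply: (@decaying_unstable_factors_eq0 _
  [seq z <- spectrum (mxC M) | predC (fun z => Re z < 0) z]).
- by move=> z; rewrite mem_filter /= -leNgt => /andP[].
- exact: decaying_mxprodXsubC.
by rewrite -mulmxA mxprodXsubC_filter_spectrum mulmx0.
Qed.

Lemma prod_sub_stable_spectrum_neq0 z :
  0 <= Re z -> \prod_(w <- stable_spectrum) (z - w) != 0.
Proof.
move=> z0; rewrite prodf_seq_neq0; apply/allP => w /stable_spectrum_lt0 w0 /=.
by apply: contraTneq w0 => /subr0_eq <-; rewrite -leNgt.
Qed.

Lemma decaying_unstable_eigencol r (v : 'cV[C]_m) z : 0 <= Re z -> decaying r ->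
  mxC M *m v = z *: v -> r *m v = 0.
Proof.
move=> z0 /decaying_stable_factors rM0 Mv; apply/eqP.
have := congr1 (mulmxr v) rM0; rewrite /= -mulmxA (mxprodXsubC_eigencol _ Mv).
rewrite mul0mx -scalemxAr => /eqP.
by rewrite scaler_eq0 (negbTE (prod_sub_stable_spectrum_neq0 z0)).
Qed.

End DecayingRows.

(* Each factor of the normalised product is [1 + (M - z) / (z - w)], so roots
   [w] far from [z] do no harm and no bound on them is needed. *)
Lemma mxprodXsubC_perturbation (F : numFieldType) m (M : 'M[F]_m) (z s K : F)
    (zs : seq F) k (y : 'cV[F]_m) :
  0 <= s -> 0 <= K -> (forall u : 'cV_m, `|(M - z%:M) *m u| <= K * `|u|) ->
  (forall w, w \in zs -> z - w != 0 /\ `|(z - w)^-1| <= s) ->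
  (size zs <= k)%N ->
  `|(\prod_(w <- zs) (z - w))^-1 *: (mxprodXsubC M zs *m y) - y|
    <= s * (\sum_(i < k) (1 + s * K) ^+ i) * `|(M - z%:M) *m y|.
Proof.
move=> s0 K0 MzK; have q0 : 0 <= 1 + s * K by rewrite addr_ge0 ?mulr_ge0.
elim: zs k => [|w zs IH] k zsP sz.
  rewrite big_nil invr1 scale1r mxprodXsubC_nil mul1mx subrr normr0.
  by rewrite !mulr_ge0 ?sumr_ge0 // => i _; rewrite exprn_ge0.
case: k sz => // k sz.
have {}IH := IH k (fun u uzs => zsP u (mem_behead (s := w :: zs) uzs)) sz.
have [w0 ws] := zsP w (mem_head _ _).
rewrite big_cons invfM mxprodXsubC_cons -mulmxA.
set y1 := _ *: (mxprodXsubC M zs *m y) in IH.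
have -> : ((z - w)^-1 * (\prod_(j <- zs) (z - j))^-1) *:
    ((M - w%:M) *m (mxprodXsubC M zs *m y)) - y =
    (y1 - y) + (z - w)^-1 *: ((M - z%:M) *m y + (M - z%:M) *m (y1 - y)).
  rewrite -mulmxDr [y + (y1 - y)]addrC subrK -scalerA scalemxAr -/y1.
  have -> : M - w%:M = (M - z%:M) + (z - w)%:M by rewrite raddfB /= addrA subrK.
  rewrite mulmxDl mul_scalar_mx scalerDr scalerA mulVf // scale1r.
  by rewrite -[LHS]addrA [LHS]addrC.
set d := `|(M - z%:M) *m y| in IH *; set g := s * \sum_(i < k) _ in IH.
have -> : s * \sum_(i < k.+1) (1 + s * K) ^+ i = g + s * (1 + K * g).
  rewrite big_ord_recl expr0; under eq_bigr do rewrite exprS.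
  by rewrite -mulr_sumr /g; ring.
apply: le_trans (ler_normD _ _) _; rewrite normrZ mulrDl lerD // -mulrA.
rewrite ler_pM // mulrDl mul1r; apply: le_trans (ler_normD _ _) _.
by rewrite lerD2l -mulrA; apply: le_trans (MzK _) _; rewrite ler_wpM2l.
Qed.

(** * Leader-follower networks *)

Lemma eq0_of_norm_le_multiples (R : realType) (x Q : R[i]) : 0 <= Q ->
  (forall w : R, 0 < w -> w <= 1 -> `|x| <= Q * w%:C%C) -> x = 0.
Proof.
move=> Q0 xQ; apply/eqP; rewrite -normr_eq0 eq_le normr_ge0 andbT.
have realE (y : R[i]) : 0 <= y -> y = (complex.Re y)%:C%C.
  by move=> y0; rewrite RRe_real // ger0_real.
rewrite (realE `|x|) // -[0]/0%:C%C lecR.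
have w0 : w @[w --> (0 : R)^'+] --> (0 : R) by exact: cvg_within.
have Qw0 : complex.Re Q * w @[w --> (0 : R)^'+] --> (0 : R).
  by rewrite -[X in _ --> X](mulr0 (complex.Re Q)); exact: cvgMr w0.
apply: (cvgr_to_ge Qw0); near=> w.
rewrite -lecR rmorphM /= -!realE //; apply: xQ; near: w.
  exact: nbhs_right_gt.
exact: nbhs_right_le.
Unshelve. all: by end_near. Qed.

Lemma norm_inv_sub_stable (R : realType) (z w : R[i]) :
  0 < complex.Re z -> complex.Re w < 0 ->
  z - w != 0 /\ `|(z - w)^-1| <= ((complex.Re z)^-1)%:C%C.
Proof.
move=> z0 w0; have zw : complex.Re z <= complex.Re (z - w) by rewrite cReB; lra.
have zw0 : 0 < complex.Re (z - w) by apply: lt_le_trans zw.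
have zwn0 : z - w != 0 by apply: contraTneq zw0 => ->; rewrite ltxx.
split=> //; rewrite normfV fmorphV lef_pV2 ?posrE ?normr_gt0 ?ltcR //.
apply: le_trans (normc_ge_Re _); rewrite lecR; apply: le_trans zw _.
exact: ler_norm.
Qed.

Section LeaderFollower.
Variable R : realType.

Definition leader_follower (w : R) : 'M[R]_2 := w *: delta_mx ord_max ord0.

Lemma leader_follower_adjacency w : 0 < w -> adjacency (leader_follower w).
Proof.
move=> w0; split=> [i j|i]; rewrite !mxE; first by rewrite mulr_ge0 // ltW.
by case: eqP => [->|]; rewrite mulr0.
Qed.

Lemma leader_follower_spanning_tree w :
  0 < w -> has_spanning_tree (leader_follower w).
Proof.
move=> w0; exists ord0 => i.
have [->|i0] := eqVneq i ord0; first exact: connect0.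
have -> : i = ord_max by apply: val_inj; case: i i0 => -[|[|]].
by apply: connect1; rewrite /edge !mxE !eqxx mulr1.
Qed.

Lemma leader_follower_eigencol w : 0 < w ->
  laplacian (leader_follower w) *m delta_mx ord_max 0
    = w *: delta_mx ord_max 0 :> 'cV[R]_2.
Proof.
move=> w0; apply/colP => i; rewrite mulmx_laplacian; last first.
  exact: leader_follower_adjacency.
rewrite big_ord_recr big_ord1 /= !mxE !eqxx.
by case: (i == ord_max); rewrite /= !(mulr1n, mulr0n); ring.
Qed.

End LeaderFollower.

Section Necessity.
Variable R : realType.
Local Notation Re := (@complex.Re R).
Variables (n nc q : nat) (A : 'M[R]_n) (B : 'cV[R]_n) (C : 'rV[R]_n).
Variables (Ac : 'M[R]_nc) (Bc : 'cV[R]_nc) (Ec : 'M[R]_(nc, q)).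
Variables (Fc : 'rV[R]_nc) (G1 : 'M[R]_1) (G2 : 'rV[R]_q) (Hc : 'M[R]_(q, nc)).

Definition uncoupled_mx : 'M[R]_(n + nc) := block_mx A (B *m Fc) 0 Ac.

Definition coupling_mx : 'M[R]_(n + nc) :=
  block_mx (B *m G1 *m C) (B *m G2 *m Hc) (Bc *m C) (Ec *m Hc).

Definition modal_mx (w : R) : 'M[R]_(n + nc) := uncoupled_mx + w *: coupling_mx.

Lemma mul_modal_mx w p (X : 'M[R]_(n + nc, p)) :
  modal_mx w *m X = col_mx
    (A *m usubmx X + B *m (Fc *m dsubmx X
       + w *: (G1 *m (C *m usubmx X)) + w *: (G2 *m (Hc *m dsubmx X))))
    (Ac *m dsubmx X + w *: (Bc *m (C *m usubmx X))
       + w *: (Ec *m (Hc *m dsubmx X))).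
Proof.
rewrite mulmxDl -scalemxAl -{1 2}[X]vsubmxK !mul_block_col.
rewrite scale_col_mx add_col_mx mul0mx add0r !scalerDr !mulmxDr -!scalemxAr.
by rewrite !mulmxA !addrA; congr col_mx; rewrite -!addrA.
Qed.

Lemma modal_closed_loop N (a : 'M[R]_N) (v : 'cV[R]_N) w
    (X : R -> 'cV[R]_(n + nc)) :
  laplacian a *m v = w *: v -> has_deriv X (fun t => modal_mx w *m X t) ->
  closed_loop A B C Ac Bc Ec Fc G1 G2 Hc a
    (fun i t => v i 0 *: usubmx (X t)) (fun i t => v i 0 *: dsubmx (X t)).
Proof.
move=> Lv Xd; apply/closed_loopP.
have vL m (Y : 'cV[R]_m) : Y *m v^T *m (laplacian a)^T = w *: (Y *m v^T).
  by rewrite -mulmxA -trmx_mul Lv linearZ /= -scalemxAr.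
split.
  apply: eq_has_deriv (has_derivMr v^T (has_deriv_usubmx Xd)) => t.
    exact: stack_scale.
  rewrite !stack_scale mul_modal_mx col_mxKu !mulmxA !vL.
  by rewrite !(mulmxDl, mulmxDr) !scalemxAl !mulmxA.
apply: eq_has_deriv (has_derivMr v^T (has_deriv_dsubmx Xd)) => t.
  exact: stack_scale.
rewrite !stack_scale mul_modal_mx col_mxKd !mulmxA !vL.
by rewrite !mulmxDl -!scalemxAl.
Qed.

Lemma row_mul_modal_mx (r : 'rV[R[i]]_n) w :
  row_mx r 0 *m mxC (modal_mx w) = row_mx
    (r *m mxC A + w%:C%C *: (r *m mxC B *m mxC (G1 *m C)))
    (r *m mxC B *m mxC (Fc + w *: (G2 *m Hc))).
Proof.
rewrite map_mxD map_mxZ !map_block_mx mulmxDr -scalemxAr !mul_row_block.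
rewrite !mul0mx !addr0 scale_row_mx add_row_mx !(map_mxD, map_mxZ, map_mxM).
by rewrite mulmxDr -scalemxAr !mulmxA.
Qed.

Lemma mul_uncoupled_mx_col (v : 'cV[R[i]]_n) :
  mxC uncoupled_mx *m col_mx v 0 = col_mx (mxC A *m v) 0.
Proof. by rewrite map_block_mx mul_block_col !mulmx0 !addr0 raddf0 mul0mx. Qed.

Lemma mul_coupling_mx_col (v : 'cV[R[i]]_n) :
  mxC coupling_mx *m col_mx v 0 =
  col_mx (mxC (B *m G1) *m (mxC C *m v)) (mxC Bc *m (mxC C *m v)).
Proof.
by rewrite map_block_mx mul_block_col !mulmx0 !addr0 !(map_mxM, mulmxA).
Qed.

Hypothesis sync : synchronizing A B C Ac Bc Ec Fc G1 G2 Hc.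

Lemma modal_decay w (X : R -> 'cV[R]_(n + nc)) : 0 < w ->
  has_deriv X (fun t => modal_mx w *m X t) ->
  tends_to_zero (fun t => usubmx (X t)).
Proof.
move=> w0 Xd k l.
have := sync (leader_follower_adjacency w0) (leader_follower_spanning_tree w0)
  (modal_closed_loop (leader_follower_eigencol w0) Xd).
by move=> /(_ ord_max ord0 k l); under eq_fun do
  rewrite [delta_mx _ _ ord_max _]mxE [delta_mx _ _ ord0 _]mxE
    scale1r scale0r subr0.
Qed.

Lemma modal_decaying_row w (r : 'rV[R[i]]_n) :
  0 < w -> decaying (modal_mx w) (row_mx r 0).
Proof.
move=> w0 X Xd; have /tends_to_zeroC/(cvg0_mulmxl r) := modal_decay w0 Xd.
suff -> : (fun t => r *m mxC (usubmx (X t))) =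
    (fun t => row_mx r 0 *m mxC (X t)).
  by [].
apply/funext => t; rewrite -[in RHS](vsubmxK (X t)) map_col_mx mul_row_col.
by rewrite mul0mx addr0.
Qed.

Lemma synchronizing_pbh_stabilizable : pbh_stabilizable A B.
Proof.
move=> z r z0 rA rB.
have := decaying_unstable_eigenrow z0 (modal_decaying_row r ltr01).
rewrite row_mul_modal_mx rA rB !mul0mx scaler0 addr0 scale_row_mx scaler0.
by move=> /(_ erefl)/eqP; rewrite row_mx_eq0 => /andP[/eqP].
Qed.

Lemma synchronizing_pbh_detectable : pbh_stabilizable A^T C^T.
Proof.
move=> z r z0 rA rC.
have Ar : mxC A *m r^T = z *: r^T.
  by rewrite -[LHS]trmxK trmx_mul trmxK map_trmx rA linearZ.
have Cr : mxC C *m r^T = 0.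
  by rewrite -[LHS]trmxK trmx_mul trmxK map_trmx rC trmx0.
have Mr : mxC (modal_mx 1) *m col_mx r^T 0 = z *: col_mx r^T 0.
  rewrite map_mxD map_mxZ mulmxDl -scalemxAl mul_uncoupled_mx_col.
  rewrite mul_coupling_mx_col Cr !mulmx0 col_mx0 scaler0 addr0 Ar.
  by rewrite scale_col_mx scaler0.
apply: trmx_inj; rewrite trmx0 -[LHS]mul1mx; apply/row_matrixP => i.
have := decaying_unstable_eigencol z0
  (modal_decaying_row (row i 1%:M) ltr01) Mr.
by rewrite mul_row_col mul0mx addr0 -row_mul => ->; rewrite row0.
Qed.

Lemma usubmx_stable_factors w : 0 < w ->
  usubmx (mxprodXsubC (mxC (modal_mx w)) (stable_spectrum (modal_mx w))) = 0.
Proof.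
move=> w0; apply/row_matrixP => i.
have := decaying_stable_factors (modal_decaying_row (row i 1%:M) w0).
rewrite -{1}[mxprodXsubC _ _]vsubmxK mul_row_col mul0mx addr0 -row_mul mul1mx.
by rewrite row0.
Qed.

Lemma modal_mx_sub_scalar w z : mxC (modal_mx w) - z%:M =
  mxC uncoupled_mx - z%:M + w%:C%C *: mxC coupling_mx.
Proof. by rewrite map_mxD map_mxZ addrAC. Qed.

Lemma mx_norm_modal_sub_scalar_mul z w (u : 'cV_(n + nc)) : 0 < w -> w <= 1 ->
  `|(mxC (modal_mx w) - z%:M) *m u| <=
    (n + nc)%:R * (`|mxC uncoupled_mx - z%:M| + `|mxC coupling_mx|) * `|u|.
Proof.
move=> w0 w1; have wC0 : 0 <= w%:C%C by rewrite ler0c ltW.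
apply: le_trans (mx_norm_mulmx _ _) _; rewrite ler_wpM2r // ler_wpM2l //.
rewrite modal_mx_sub_scalar.
apply: le_trans (ler_normD _ _) _; rewrite lerD2l normrZ.
by rewrite (ger0_norm wC0) ler_piMl // -[1]/1%:C%C lecR.
Qed.

Lemma modal_mx_sub_eigenvalue_mul z w (v : 'cV_n) : mxC A *m v = z *: v ->
  (mxC (modal_mx w) - z%:M) *m col_mx v 0 =
  w%:C%C *: (mxC coupling_mx *m col_mx v 0).
Proof.
move=> Av; rewrite modal_mx_sub_scalar mulmxDl mulmxBl mul_uncoupled_mx_col Av.
by rewrite mul_scalar_mx scale_col_mx scaler0 subrr add0r scalemxAl.
Qed.

(* An unstable mode of [A] survives, up to an error [O(w)], as [w] tends to
   [0]. *)
Lemma unstable_mode_bound z (v : 'cV[R[i]]_n) : 0 < Re z ->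
  mxC A *m v = z *: v -> exists2 Q : R[i], 0 <= Q &
  forall w : R, 0 < w -> w <= 1 -> `|v| <= Q * w%:C%C.
Proof.
move=> z0 Av; pose y := col_mx v (0 : 'cV_nc).
pose s : R[i] := (Re z)^-1%:C%C.
have s0 : 0 <= s by rewrite ler0c invr_ge0 ltW.
pose K := (n + nc)%:R * (`|mxC uncoupled_mx - z%:M| + `|mxC coupling_mx|).
have K0 : 0 <= K by rewrite mulr_ge0 // addr_ge0.
pose g := s * \sum_(i < n + nc) (1 + s * K) ^+ i.
have g0 : 0 <= g.
  rewrite mulr_ge0 // sumr_ge0 // => i _.
  by rewrite exprn_ge0 // addr_ge0 ?mulr_ge0.
exists (g * `|mxC coupling_mx *m y|) => [|w w0 w1]; first by rewrite mulr_ge0.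
have wC0 : 0 <= w%:C%C by rewrite ler0c ltW.
have := mxprodXsubC_perturbation y s0 K0
  (fun u => mx_norm_modal_sub_scalar_mul z u w0 w1)
  (fun u uM => norm_inv_sub_stable z0 (stable_spectrum_lt0 uM))
  (size_stable_spectrum (modal_mx w)).
rewrite -/g modal_mx_sub_eigenvalue_mul // normrZ (ger0_norm wC0).
rewrite mulrCA [leRHS]mulrC; apply: le_trans.
apply: le_trans (mx_norm_usubmx _).
rewrite linearB linearZ /= -mul_usub_mx usubmx_stable_factors // mul0mx scaler0.
by rewrite sub0r normrN col_mxKu.
Qed.

Lemma synchronizing_closed_lhp : eig_closed_lhp A.
Proof.
move=> z /eigencolP[v Av v0]; rewrite leNgt; apply: contra v0 => z0.
have [Q Q0 vQ] := unstable_mode_bound z0 Av.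
apply/eqP/colP => k; rewrite mxE.
apply: (eq0_of_norm_le_multiples Q0) => w w0 w1.
exact: le_trans (mx_entry_le_norm _ _ _) (vQ w w0 w1).
Qed.

End Necessity.

Theorem theorem5 (R : realType) (n : nat)
  (A : 'M[R]_n) (B : 'M[R]_(n, 1)) (C : 'M[R]_(1, n)) :
  (exists (nc q : nat) (Ac : 'M[R]_nc) (Bc : 'M[R]_(nc, 1)) (Ec : 'M[R]_(nc, q))
          (Fc : 'M[R]_(1, nc)) (G1 : 'M[R]_1) (G2 : 'M[R]_(1, q))
          (Hc : 'M[R]_(q, nc)),
     forall (N : nat) (a : 'M[R]_N),
       adjacency a -> has_spanning_tree a ->
       forall (x : 'I_N -> R -> 'cV[R]_n) (xc : 'I_N -> R -> 'cV[R]_nc),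
         closed_loop A B C Ac Bc Ec Fc G1 G2 Hc a x xc ->
         forall i j : 'I_N, tends_to_zero (fun t => x i t - x j t))
  <->
  (hurwitz A \/ (stabilizable A B /\ detectable C A /\ eig_closed_lhp A)).
Proof.
split=> [[nc [q [Ac [Bc [Ec [Fc [G1 [G2 [Hc sync]]]]]]]]]|solvable].
  right; split.
    exact/stabilizable_of_pbh/synchronizing_pbh_stabilizable/sync.
  split; last exact: synchronizing_closed_lhp sync.
  apply/detectable_of_stabilizable_tr/stabilizable_of_pbh.
  exact: synchronizing_pbh_detectable sync.
have [[F hF] [[K hK] hA]] :
    stabilizable A B /\ detectable C A /\ eig_closed_lhp A.
  case: solvable => // hA; split; first by exists 0; rewrite mulmx0 addr0.
  split; first by exists 0; rewrite mul0mx addr0.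
  by move=> z /hA /ltW.
do 9!eexists; exact: observer_protocol_synchronizing hF hK hA.
Qed.
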